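(* Let $1\leq p<N$ and $p^*\leq r<q<\infty$, where $p^*=\frac{Np}{N-p}$. Let $K,V:\mathbf{R}^N\to(0,\infty)$ be Lebesgue measurable functions such that $K\in L^\alpha_{loc}(\mathbf{R}^N)$ for some $\alpha\in\left(\frac{q}{q-r},\infty\right]$; for each compact $D\subset\mathbf{R}^N$ there is a constant $V_D>0$ with $\inf_D V\geq V_D$; and $K^{\frac{q}{q-r}}V^{-\frac{r}{q-r}}\in L^1(\mathbf{R}^N)$. Then the embedding $M^{q,p}_V(\mathbf{R}^N)\hookrightarrow L^r_K(\mathbf{R}^N)$ is compact.
   Context: For a positive weight $W$ and $1\le t<\infty$, $L^t_W(\mathbf{R}^N)=\{u\in L^1_{loc}(\mathbf{R}^N):\|u\|^t_{L^t_W}=\int_{\mathbf{R}^N}|u|^tW\,dx<\infty\}$. For $1\le p<N$, $D^{1,p}(\mathbf{R}^N)$ is the space of functions $u\in L^{p^*}(\mathbf{R}^N)$ with weak gradient $|\nabla u|\in L^p(\mathbf{R}^N)$, and $M^{q,p}_V(\mathbf{R}^N)=\{u\in D^{1,p}(\mathbf{R}^N):\|u\|_{M^{q,p}_V}=\|u\|_{L^q_V}+\|\nabla u\|_{L^p}<\infty\}$. *)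

(* Defs.v *)
From HB Require Import structures.
From mathcomp Require Import all_boot all_order all_algebra.
From mathcomp Require Import all_classical all_reals all_analysis.

Set Implicit Arguments.
Unset Strict Implicit.
Unset Printing Implicit Defensive.

Import Order.TTheory GRing.Theory Num.Theory.
Import numFieldNormedType.Exports.

Local Open Scope classical_set_scope.
Local Open Scope ring_scope.

Section tuple_lebesgue_succ.
Context {R : realType} (n : nat).
Local Notation RT := (measurableTypeR R).
Variable m : {sigma_finite_measure set (n.-tuple RT) -> \bar R}.

Definition tcons (x : RT * n.-tuple RT) : n.+1.-tuple RT :=
  [the n.+1.-tuple RT of x.1 :: x.2].

Lemma measurable_tcons : measurable_fun [set: RT * n.-tuple RT] tcons.
Proof. exact: measurable_cons. Qed.

Definition tuple_lebesgue_succ : set (n.+1.-tuple RT) -> \bar R :=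
  pushforward (lebesgue_measure \x m)%E tcons.

Let pushforward_tcons : {measure set (n.+1.-tuple RT) -> \bar R} :=
  measure_function_pushforward__canonical__measure_function_Measure
    (lebesgue_measure \x m)%E measurable_tcons.

HB.instance Definition _ := isMeasure.Build _ _ _ tuple_lebesgue_succ
  (@measure0 _ _ _ pushforward_tcons) (@measure_ge0 _ _ _ pushforward_tcons)
  (@measure_semi_sigma_additive _ _ _ pushforward_tcons).

Let tuple_lebesgue_succ_sigma_finite : sigma_finite setT tuple_lebesgue_succ.
Proof.
have /sigma_finiteP[F [FT ndF Foo]] := sigma_finiteT (@lebesgue_measure R).
have /sigma_finiteP[G [GT ndG Goo]] := sigma_finiteT m.
pose g (t : n.+1.-tuple RT) : RT * n.-tuple RT := (thead t, [tuple of behead t]).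
have mg : measurable_fun setT g.
  apply/measurable_fun_pair => /=; first exact: measurable_tnth.
  exact: measurable_behead.
have tconsK : g \o tcons = id.
  apply/funext => -[x t]; rewrite /g /tcons /= theadE; congr pair.
  exact: val_inj.
exists (fun k => g @^-1` (F k `*` G k)).
  rewrite -preimage_bigcup [X in g @^-1` X](_ : _ = setT) ?preimage_setT//.
  rewrite -subTset => -[x t] _.
  have [i _ Fix] : (\bigcup_i F i) x by rewrite -FT.
  have [j _ Gjt] : (\bigcup_i G i) t by rewrite -GT.
  exists (maxn i j) => //; split => /=.
    by move: Fix; exact/subsetPset/ndF/leq_maxl.
  by move: Gjt; exact/subsetPset/ndG/leq_maxr.
move=> k; have [mF Fk] := Foo k; have [mG Gk] := Goo k; split.
  by rewrite -[X in measurable X]setTI; apply: mg => //; exact: measurableX.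
rewrite /tuple_lebesgue_succ /pushforward -comp_preimage tconsK.
by rewrite product_measure1E// lte_mul_pinfty// ge0_fin_numE.
Qed.

HB.instance Definition _ := Measure_isSigmaFinite.Build _ _ _
  tuple_lebesgue_succ tuple_lebesgue_succ_sigma_finite.

End tuple_lebesgue_succ.


Fixpoint tuple_lebesgue (R : realType) (n : nat) :
    {sigma_finite_measure set (n.-tuple (measurableTypeR R)) -> \bar R} :=
  match n with
  | 0 => \d_([tuple])
  | n'.+1 => tuple_lebesgue_succ (tuple_lebesgue R n')
  end.

(* 'rV[R]_N carries the Lebesgue sigma-algebra (the Caratheodory measurable
   sets, hence all null sets included), not the Borel one, and
   [lebesgueRn R N] is the complete N-dimensional Lebesgue measure on it. *)
Section lebesgueRn.
Context {R : realType} (N : nat).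
Local Notation tN := (N.-tuple (measurableTypeR R)).

Definition row_of_tuple (t : tN) : 'rV[R]_N := \row_i tnth t i.

Definition lebesgue_measurable : set (set 'rV[R]_N) :=
  image_set_system [set: tN] row_of_tuple
    (((tuple_lebesgue R N)^*)%mu.-cara.-measurable).

Let lebesgue_sigma_algebra : sigma_algebra setT lebesgue_measurable.
Proof.
apply: sigma_algebra_image; exact: sigma_algebra_measurable.
Qed.

Let lebesgue_measurable0 : lebesgue_measurable set0.
Proof. by case: lebesgue_sigma_algebra. Qed.

Let lebesgue_measurableC A :
  lebesgue_measurable A -> lebesgue_measurable (~` A).
Proof. by case: lebesgue_sigma_algebra => _ + _ => /[apply]; rewrite setTD. Qed.

Let lebesgue_measurable_bigcup (F : (set 'rV[R]_N)^nat) :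
  (forall i, lebesgue_measurable (F i)) ->
  lebesgue_measurable (\bigcup_i F i).
Proof. by case: lebesgue_sigma_algebra => _ _; exact. Qed.

HB.instance Definition _ := @isMeasurable.Build default_measure_display
  'rV[R]_N lebesgue_measurable lebesgue_measurable0 lebesgue_measurableC
  lebesgue_measurable_bigcup.

Local Notation ctN := (caratheodory_type ((tuple_lebesgue R N)^*)%mu).

Lemma measurable_row_of_tuple :
  measurable_fun [set: ctN] (row_of_tuple : ctN -> 'rV[R]_N).
Proof. by move=> _ A. Qed.

Definition lebesgueRn : set 'rV[R]_N -> \bar R :=
  pushforward (@completed_measure_extension _ _ _ (tuple_lebesgue R N))
    (row_of_tuple : ctN -> 'rV[R]_N).

Let pushforward_row : {measure set 'rV[R]_N -> \bar R} :=
  measure_function_pushforward__canonical__measure_function_Measure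
    (@completed_measure_extension _ _ _ (tuple_lebesgue R N)) measurable_row_of_tuple.

HB.instance Definition _ := isMeasure.Build _ _ _ lebesgueRn
  (@measure0 _ _ _ pushforward_row) (@measure_ge0 _ _ _ pushforward_row)
  (@measure_semi_sigma_additive _ _ _ pushforward_row).

End lebesgueRn.
Arguments lebesgueRn R N : clear implicits.

Lemma tuple_lebesgue_box (R : realType) (N : nat)
    (A : 'I_N -> set (measurableTypeR R)) :
  (forall i, measurable (A i)) ->
  let B := [set t : N.-tuple (measurableTypeR R) | forall i, A i (tnth t i)] in
  measurable B /\
  (tuple_lebesgue R N B = \prod_(i < N) lebesgue_measure (A i))%E.
Proof.
elim: N A => [|N IH] A mA B.
  have -> : B = setT by rewrite -subTset => t _ [].
  by split => //; rewrite big_ord0 /= diracT.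
have [mB' E] := IH (A \o lift ord0) (fun i => mA _).
set B' := [set t | _] in mB' E.
have mB : measurable B.
  have -> : B = \bigcap_(i in [set: 'I_N.+1]) ((fun t => tnth t i) @^-1` A i).
    by apply/seteqP; split => [t Bt i _ /=|t Bt i]; [exact: Bt|exact: (Bt i)].
  apply: fin_bigcap_measurable => // i _.
  by rewrite -[X in measurable X]setTI; apply: measurable_tnth.
split=> //=.
rewrite /tuple_lebesgue_succ /pushforward.
have -> : @tcons R N @^-1` B = A ord0 `*` B'.
  apply/seteqP; split => -[x t] /=.
    move=> Bt; split; first by have := Bt ord0.
    by move=> i /=; have := Bt (lift ord0 i); rewrite tnthS.
  move=> [Ax Bt] i; case: (unliftP ord0 i) => [j|] -> //.
  by rewrite tnthS; exact: Bt.
by rewrite product_measure1E// big_ord_recl E.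
Qed.

Lemma lebesgueRn_box (R : realType) (N : nat)
    (A : 'I_N -> set (measurableTypeR R)) : (forall i, measurable (A i)) ->
  (lebesgueRn R N [set x | forall i, A i (x 0%R i)] =
   \prod_(i < N) lebesgue_measure (A i))%E.
Proof.
move=> /(@tuple_lebesgue_box R N)[mB <-].
rewrite /lebesgueRn /pushforward /completed_measure_extension.
rewrite -measurable_mu_extE//; congr (mu_ext _ _).
by apply/seteqP; split => t /= At i; have := At i; rewrite mxE.
Qed.

Section test_functions.
Context {R : realType} {N : nat}.
Implicit Types phi : 'rV[R]_N -> R.

Definition partial (i : 'I_N) phi : 'rV[R]_N -> R :=
  'D_(delta_mx 0 i : 'rV[R]_N) phi.

Definition iter_partial (s : seq 'I_N) phi := foldr partial phi s.

Definition smooth phi := forall s : seq 'I_N,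
  continuous (iter_partial s phi) /\
  forall i x, derivable (iter_partial s phi) x (delta_mx 0 i : 'rV[R]_N).

Definition test_function phi :=
  smooth phi /\ compact (closure [set x | phi x != 0]).

End test_functions.

Definition sobolev_exponent {R : realType} (N : nat) (p : R) : R :=
  N%:R * p / (N%:R - p).

Section function_spaces.
Context {R : realType} {N : nat}.
Local Notation mu := (lebesgueRn R N).
Implicit Types (u W : 'rV[R]_N -> R) (G : 'rV[R]_N -> 'rV[R]_N) (t p : R).

Definition L1loc u := measurable_fun setT u /\
  forall D : set 'rV[R]_N, compact D -> (\int[mu]_(x in D) `|u x|%:E < +oo)%E.

Definition Lloc (a : \bar R) u :=
  forall D : set 'rV[R]_N, compact D -> (u \_ D) \in Lfun mu a.

Definition wLnorm t W u : \bar R :=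
  ((\int[mu]_x (`|u x| `^ t * W x)%:E) `^ t^-1)%E.

Definition wL t W : set ('rV[R]_N -> R) :=
  [set u | L1loc u /\ (\int[mu]_x (`|u x| `^ t * W x)%:E < +oo)%E].

(* The norm of the library on row vectors is the sup norm. *)
Definition enorm (v : 'rV[R]_N) : R := Num.sqrt (\sum_i v 0 i ^+ 2).

Definition is_weak_gradient u G :=
  L1loc u /\ forall i : 'I_N,
    L1loc (fun x => G x 0 i) /\
    forall phi, test_function phi ->
      (\int[mu]_x (u x * partial i phi x)%:E =
       - \int[mu]_x (G x 0 i * phi x)%:E)%E.

(* Weak gradients are unique almost everywhere: [wgrad] picks a representative. *)
Definition wgrad u : 'rV[R]_N -> 'rV[R]_N := xget (cst 0) (is_weak_gradient u).

Definition D1 p : set ('rV[R]_N -> R) :=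
  [set u | [/\ u \in Lfun mu (sobolev_exponent N p)%:E,
               exists G, is_weak_gradient u G &
               enorm \o wgrad u \in Lfun mu p%:E]].

Definition Mnorm q p V u : \bar R :=
  (wLnorm q V u + 'N[mu]_p%:E[EFin \o (enorm \o wgrad u)])%E.

Definition Mspace q p V : set ('rV[R]_N -> R) :=
  [set u | D1 p u /\ (Mnorm q p V u < +oo)%E].

(* The spaces are represented by functions, not classes of functions modulo
   equality almost everywhere, so that nX and nY below are seminorms. *)
Definition compact_embedding (X Y : set ('rV[R]_N -> R))
    (nX nY : ('rV[R]_N -> R) -> \bar R) :=
  [/\ X `<=` Y,
      exists C : R, forall u, X u -> (nY u <= C%:E * nX u)%E &
      forall u_ : nat -> 'rV[R]_N -> R,
        (forall n, X (u_ n)) -> (exists B : R, forall n, (nX (u_ n) <= B%:E)%E) ->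
        exists2 s : nat -> nat, {homo s : m n / (m < n)%N} &
        exists2 v, Y v &
          nY (fun x => u_ (s k) x - v x) @[k --> \oo] --> 0%E].

End function_spaces.

(* Main.v *)
Require Import Defs.
From mathcomp Require Import all_boot all_order all_algebra.
From mathcomp Require Import all_classical all_reals all_analysis.
From mathcomp Require Import measurable_realfun ring lra.

Set Implicit Arguments.
Unset Strict Implicit.
Unset Printing Implicit Defensive.

Import Order.TTheory GRing.Theory Num.Theory.
Import numFieldNormedType.Exports.

Local Open Scope classical_set_scope.
Local Open Scope ring_scope.

(* Write |u|^r K = X^t Y^(1-t) with X = |u|^q V, Y = K^(q/(q-r)) V^(-r/(q-r)) and
   t = r/q. For every s > 0 it is at most s^t (X/s + Y), which gives the continuity
   of the embedding. For every d > 0 it is also at most d X + min(|u|^r K, L Y) for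
   some L, and the minimum is dominated by the integrable function L Y: hence for a
   bounded sequence almost everywhere convergence implies convergence in L^r_K.

   An almost everywhere convergent subsequence comes from the L^1 bounds for u and
   its weak gradient on cubes. Testing the weak gradient against (tent function in
   x_i) (x) (cutoffs in the other variables) shows that the integrals of u over the
   two halves of a box differ by at most half of its side times the integral of
   |d_i u|. Bisecting repeatedly, the distance in L^1(cube) from u to the dyadic step
   function of its averages is O(2^-k) times the L^1 norm of the gradient; the step
   functions of level k form a finite-dimensional space, so the sequence is totally
   bounded in L^1(cube) for every cube. *)

(** The local argument stays in L^1, where pairing with a test function uses only its sup norm. The
    L^1 bounds come from |a| <= 1 + |a|^q for [u], with V bounded below on cubes, and from |a| <= 1
    + |a|^p for the gradient. The definition of weak gradient admits only smooth test functions,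
    whereas the tent and the indicators that compare two halves are not smooth; they are
    approximated by explicit functions built from exp(-1/x). The estimates between dyadic levels
    only show that the averages of [u] converge to some function. That this function is [u] is
    proved by comparing integrals, on dyadic boxes, then on Borel sets by the pi-lambda theorem,
    then on Lebesgue measurable sets up to null sets. The subsequence is found along an ultrafilter,
    for which the averages over all boxes of all levels converge at once. Its limit is only known to
    be measurable; Fatou's lemma puts it in L^r_K. *)

(** * Construction of smooth test functions with compact support *)

Section smooth_functions_of_one_variable.
Context {R : realType}.
Implicit Types f g : R -> R.

Definition smooth1 f := forall n (x : R), derivable (derive1n n f) x 1.

Lemma is_derive_derive1 f df :
  (forall x : R, is_derive x 1 f (df x)) -> (derive1 f) = df.
Proof. by move=> fd; apply/funext => x; rewrite derive1E derive_val. Qed.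

(** Coinduction: smoothness is proved by exhibiting a class of functions stable under
    differentiation, so that no formula for n-th derivatives has to be found. *)
Lemma smooth1_class (C : set (R -> R)) f : C f ->
  (forall g, C g -> exists2 dg, C dg & forall x : R, is_derive x 1 g (dg x)) ->
  smooth1 f.
Proof.
move=> Cf CD n x.
suff : C (derive1n n f) by move=> /CD[dg _ /(_ x)[]].
elim: n => [//|n /CD[dg Cdg gdg]].
by rewrite derive1nS (is_derive_derive1 gdg).
Qed.

Lemma smooth1_derive f : smooth1 f -> smooth1 (derive1 f).
Proof. by move=> sf n x; rewrite -derive1Sn; exact: sf. Qed.

Lemma smooth1_is_derive f (x : R) : smooth1 f -> is_derive x 1 f (derive1 f x).
Proof. by move=> /(_ 0%N x) fd; rewrite derive1E; exact: derivableP. Qed.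

Lemma smooth1_primitive f df : (forall x : R, is_derive x 1 f (df x)) ->
  smooth1 df -> smooth1 f.
Proof.
move=> fdf sdf [|n] x; first by case: (fdf x).
by rewrite derive1Sn (is_derive_derive1 fdf); exact: sdf.
Qed.

Lemma smooth1_continuous f : smooth1 f -> continuous f.
Proof.
by move=> /(_ 0%N) fd x; exact/differentiable_continuous/derivable1_diffP/fd.
Qed.

Lemma smooth1B f g : smooth1 f -> smooth1 g -> smooth1 (f - g).
Proof.
move=> sf sg.
pose C := [set h | exists f' g', [/\ smooth1 f', smooth1 g' & h = f' - g']].
apply: (@smooth1_class C); first by exists f, g.
move=> _ [f1 [g1 [sf1 sg1 ->]]]; exists (derive1 f1 - derive1 g1).
  by exists (derive1 f1), (derive1 g1); split => //; exact: smooth1_derive.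
by move=> x; apply: is_deriveB; exact: smooth1_is_derive.
Qed.

(** By the Leibniz rule a product of smooth functions differentiates to a sum of two such products;
    finite sums are added to obtain a class stable under differentiation. *)
Inductive product_closure : (R -> R) -> Prop :=
| product_closureM f g : smooth1 f -> smooth1 g -> product_closure (f * g)
| product_closureD f g : product_closure f -> product_closure g ->
    product_closure (f + g).

Lemma smooth1M f g : smooth1 f -> smooth1 g -> smooth1 (f * g).
Proof.
move=> sf sg; apply: (@smooth1_class product_closure).
  exact: product_closureM.
move=> h; elim=> {f g sf sg h} [f g sf sg|f g _ [df Cdf fdf] _ [dg Cdg gdg]].
  exists (f * derive1 g + g * derive1 f).
    by apply: product_closureD; apply: product_closureM => //;
      exact: smooth1_derive.
  move=> x; have := smooth1_is_derive x sf; have := smooth1_is_derive x sg.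
  by move=> dg df; apply: is_derive_eq.
exists (df + dg); first exact: product_closureD.
by move=> x; apply: is_deriveD.
Qed.

Lemma smooth1_comp_affine f (c d : R) :
  smooth1 f -> smooth1 (fun x => f (c * x + d)).
Proof.
move=> sf.
(* Each differentiation brings out a factor [c]; the scalar [k] absorbs it. *)
pose C := [set h | exists2 k : R, True &
  exists2 f', smooth1 f' & h = fun x => k * f' (c * x + d)].
apply: (@smooth1_class C).
  by exists 1 => //; exists f => //; apply/funext => x; rewrite mul1r.
move=> _ [k _ [f' sf' ->]]; exists (fun x => k * c * derive1 f' (c * x + d)).
  by exists (k * c) => //; exists (derive1 f') => //; exact: smooth1_derive.
move=> x.
have aff : is_derive x 1 (fun x => c * x + d) c.
  have -> : (fun x => c * x + d) = (c *: (@id R) + cst d).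
    by apply/funext.
  by apply: is_derive_eq; rewrite addr0 [_ *: _]mulr1.
have := @is_derive1_comp _ f' (fun x => c * x + d) x _ c
  (smooth1_is_derive (c * x + d) sf') aff.
move=> dc; have -> : (fun x => k * f' (c * x + d)) =
  k *: (f' \o (fun x => c * x + d)) by apply/funext.
by apply: is_derive_eq; rewrite [_ *: _]mulrA (mulrAC k).
Qed.

End smooth_functions_of_one_variable.

Section flat_function.
Context {R : realType}.
Implicit Types (P : {poly R}) (x y : R).

(** For [P = 1] this is the classical exp(-1/x), flat at 0; the derivatives of that function have
    this form with other polynomials in 1/x. *)
Definition flat P x : R := if 0 < x then P.[x^-1] * expR (- x^-1) else 0.

(** For y >= 0 each y^i / i! is below e^y; the constant collects the coefficients with their
    factorials. *)
Lemma horner_le_expR P : exists C, forall y, 0 <= y -> `|P.[y]| <= C * expR y.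
Proof.
exists (\sum_(i < size P) `|P`_i| * i`!%:R) => y y0.
rewrite horner_coef mulr_suml (le_trans (ler_norm_sum _ _ _))//.
apply: ler_sum => i _; rewrite normrM -mulrA ler_wpM2l//.
rewrite ger0_norm ?exprn_ge0//; case: (nat_of_ord i) => [|n].
  by rewrite expr0 mul1r (le_trans _ (expR_ge1Dx y))// lerDl.
rewrite mulrC -ler_pdivrMr ?ltr0n ?fact_gt0//.
by apply: le_trans (expR_ge1Dxn n y0); rewrite lerDr.
Qed.

Lemma flat_continuous0 P : {for 0, continuous (flat P)}.
Proof.
(* One factor ['X] more than in [P]: with y = 1/x the bound becomes |flat P x| <= |C| |x|. *)
have [C hC] := horner_le_expR ('X * P).
rewrite /prop_for /continuous_at /flat ltxx.
have hb x : `|flat P x| <= `|C| * `|x|.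
  rewrite /flat; case: ifPn => x0; last by rewrite normr0 mulr_ge0.
  have y0 : 0 < x^-1 by rewrite invr_gt0.
  have := hC _ (ltW y0); rewrite hornerM hornerX normrM (gtr0_norm y0).
  rewrite ler_pdivrMl// => h.
  rewrite normrM (gtr0_norm (expR_gt0 _)) expRN ler_pdivrMr ?expR_gt0//.
  apply: (le_trans h); rewrite (gtr0_norm x0) mulrCA -[leRHS]mulrA.
  by rewrite ler_wpM2r ?ler_norm// mulr_ge0 ?expR_ge0// ltW.
apply/norm_cvg0P; apply: (@squeeze_cvgr _ _ _ _ (cst 0) (fun x => `|C| * `|x|)).
- by near=> x => /=; rewrite normr_ge0 hb.
- exact: cvg_cst.
- rewrite [X in _ --> X](_ : 0 = `|C| * `|0 : R|); last by rewrite normr0 mulr0.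
  by apply: cvgMr; apply: cvg_norm; exact: cvg_id.
Unshelve. all: by end_near. Qed.

(** With y = 1/x and dy/dx = - y^2, the product rule for P(y) exp(-y) gives the formula. At 0 the
    difference quotient is [flat ('X * P)], which is continuous there. *)
Lemma is_derive_flat P x : is_derive x 1 (flat P) (flat ('X^2 * (P - P^`())) x).
Proof.
have [x0|x0|->] := ltgtP x 0.
- apply: (@near_eq_is_derive _ _ _ (cst 0)).
    near=> y; rewrite /flat ifF//; apply/negbTE; rewrite -leNgt; apply/ltW.
    by near: y; exact: lt_nbhsl.
  by apply: is_derive_eq; rewrite /flat ltNge ltW.
- apply: (@near_eq_is_derive _ _ _
    ((horner P \o (fun y => y^-1)) * (expR \o (fun y => - y^-1)))).
    near=> y; rewrite /flat ifT//.
    by near: y; exact: lt_nbhsr.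
  have x1 : x != 0 by rewrite gt_eqF.
  have dV : is_derive x 1 (fun y : R => y^-1) (- x ^- 2).
    by have := @is_deriveV _ id x 1 1 x1 _; rewrite [_ *: _]mulr1; exact.
  have dN : is_derive x 1 (fun y : R => - y^-1) (x ^- 2).
    have := is_deriveN dV; rewrite opprK; exact.
  have d1 := is_derive1_comp (is_derive_poly P x^-1) dV.
  have d2 := @is_derive1_comp _ expR _ x _ _ (is_derive_expR (- x^-1)) dN.
  apply: is_derive_eq; rewrite /flat x0 /=.
  rewrite !hornerM hornerD hornerN !hornerE /GRing.scale/= -exprVn; ring.
- apply/is_derive1_caratheodory; exists (flat ('X * P)); split.
  + move=> z; rewrite /flat ltxx !subr0; case: ifPn => z0; last by rewrite mul0r.
    by rewrite !hornerE mulrAC (mulrAC z^-1) mulVf ?mul1r ?gt_eqF.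
  + exact: flat_continuous0.
  + by rewrite /flat ltxx.
Unshelve. all: by end_near. Qed.

Lemma smooth1_flat P : smooth1 (flat P).
Proof.
apply: (@smooth1_class _ [set f | exists P, f = flat P]); first by exists P.
move=> _ [Q ->]; exists (flat ('X^2 * (Q - Q^`()))).
  by eexists; reflexivity.
exact: is_derive_flat.
Qed.

Lemma flat1_ge0 x : 0 <= flat 1 x.
Proof. by rewrite /flat; case: ifP => // _; rewrite hornerE mul1r expR_ge0. Qed.

Lemma flat1_le1 x : flat 1 x <= 1.
Proof.
rewrite /flat; case: ifP => // x0; rewrite hornerE mul1r -expR0 ler_expR.
by rewrite oppr_le0 invr_ge0 ltW.
Qed.

Lemma flat1_eq0 x : x <= 0 -> flat 1 x = 0.
Proof. by rewrite /flat ltNge => ->. Qed.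

Lemma flat1_cvg x : 0 < x -> flat 1 (k.+1%:R * x) @[k --> \oo] --> (1 : R).
Proof.
move=> x0.
have -> : (fun k => flat 1 (k.+1%:R * x)) =
    (fun k => expR (- (k.+1%:R^-1 * x^-1))).
  apply/funext => k; rewrite /flat mulr_gt0// hornerE mul1r invfM//.
rewrite -[X in _ --> X]expR0.
apply: continuous_cvg; first exact: continuous_expR.
rewrite -[X in _ --> X]oppr0; apply: cvgN.
rewrite -[X in _ --> X](mul0r x^-1); apply: cvgMl.
exact: cvg_harmonic.
Qed.

End flat_function.

Section cutoff_functions.
Context {R : realType}.
Implicit Types (a b c x : R) (k : nat).

(** The factors vanish for x <= a and for x >= b respectively and tend to 1 elsewhere: a smooth
    approximation of the indicator of ]a, b[. *)
Definition cutoff a b k x : R :=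
  flat 1 (k.+1%:R * (x - a)) * flat 1 (k.+1%:R * (b - x)).

Lemma smooth1_cutoff a b k : smooth1 (cutoff a b k).
Proof.
rewrite (_ : cutoff a b k =
  (fun x => flat 1 (k.+1%:R * x + - (k.+1%:R * a))) *
  (fun x => flat 1 (- k.+1%:R * x + k.+1%:R * b))).
  by apply: smooth1M; apply: smooth1_comp_affine; exact: smooth1_flat.
apply/funext => x; rewrite /cutoff; congr (flat 1 _ * flat 1 _); ring.
Qed.

Lemma cutoff_ge0 a b k x : 0 <= cutoff a b k x.
Proof. by rewrite mulr_ge0 ?flat1_ge0. Qed.

Lemma cutoff_le1 a b k x : cutoff a b k x <= 1.
Proof. by rewrite mulr_ile1 ?flat1_ge0 ?flat1_le1. Qed.

Lemma cutoff_eq0 a b k x : ~~ (a < x < b) -> cutoff a b k x = 0.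
Proof.
rewrite negb_and -!leNgt => /orP[xa|bx]; rewrite /cutoff.
  by rewrite flat1_eq0 ?mul0r// pmulr_rle0// subr_le0.
by rewrite [X in _ * X]flat1_eq0 ?mulr0// pmulr_rle0// subr_le0.
Qed.

Lemma cutoff_cvg a b x : cutoff a b k x @[k --> \oo] --> ((a < x < b)%R%:R : R).
Proof.
have [/andP[ax xb]|axb] := boolP (a < x < b)%R.
  rewrite -[X in _ --> X](mul1r 1); apply: cvgM; apply: flat1_cvg;
  by rewrite subr_gt0.
rewrite (_ : (fun k => _) = cst 0); first exact: cvg_cst.
by apply/funext => k; rewrite cutoff_eq0.
Qed.

Lemma cutoff_shift a b c k x : cutoff a b k (x - c) = cutoff (a + c) (b + c) k x.
Proof. by rewrite /cutoff; congr (flat 1 _ * flat 1 _); ring. Qed.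

Lemma cutoff_primitive a b k :
  exists E : R -> R, forall x, is_derive x 1 E (cutoff a b k x).
Proof.
exists (fun x => \int[lebesgue_measure]_(t in [set` `]-oo, x]]) (cutoff a b k t))%R.
move=> x.
have ccont : continuous (cutoff a b k).
  by apply: smooth1_continuous; exact: smooth1_cutoff.
have cint u : (@lebesgue_measure R).-integrable
    [set` `]-oo, u]] (EFin \o cutoff a b k).
  apply: (@integrableS _ _ _ _ setT) => //.
  rewrite (_ : EFin \o cutoff a b k = (EFin \o cutoff a b k) \_ `[a, b]).
    apply/(integrable_mkcond _ _).1 => //.
    apply: continuous_compact_integrable; first exact: segment_compact.
    exact: continuous_subspaceT.
  apply/funext => t; rewrite patchE; case: ifPn => //.
  rewrite notin_setE /= in_itv /= => /negP tab; rewrite cutoff_eq0//.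
  by apply: contra tab => /andP[/ltW -> /ltW ->].
have xx1 : x < x + 1 by rewrite ltrDl.
have [] := @continuous_FTC1 R (cutoff a b k) -oo%O x (x + 1) xx1 (cint _)
  (ltNyr _) (ccont x).
by move=> dE <-; rewrite derive1E; exact: derivableP.
Qed.

(** [h x] is the integral of [cutoff a m k] over the window [x - tau, x], with tau = (b - a) / 2: a
    smoothed tent. Translation by tau maps ]a, m[ onto ]m, b[, which gives the derivative; the
    window has length tau, and it misses ]a, m[ when x is outside ]a, b[. *)
Lemma hat_function a b k (m := (a + b) / 2) : a <= b ->
  exists h : R -> R, [/\ smooth1 h,
    derive1 h = (fun x => cutoff a m k x - cutoff m b k x),
    (forall x, `|h x| <= (b - a) / 2) &
    forall x, ~~ (a < x < b) -> h x = 0].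
Proof.
move=> ab; have [E dE] := cutoff_primitive a m k.
pose tau := (b - a) / 2.
have dEt x : is_derive x 1 (fun x => E (1 * x + - tau)) (cutoff m b k x).
  have -> : (fun x => E (1 * x + - tau)) = E \o (shift (- tau)).
    by apply/funext => y /=; rewrite mul1r.
  have dS : is_derive x (1 : R) (shift (- tau)) (1 : R) by exact: is_derive_shift.
  have := is_derive1_comp (dE _) dS.
  rewrite mulr1 /= cutoff_shift (_ : a + tau = m); last by rewrite /m /tau; field.
  by rewrite (_ : m + tau = b) // /m /tau; field.
have sE : smooth1 E by apply: smooth1_primitive dE _; exact: smooth1_cutoff.
have sEt : smooth1 (fun x => E (1 * x + - tau)).
  exact: smooth1_comp_affine.
pose h := E - (fun x => E (1 * x + - tau)).
have tau0 : 0 <= tau by rewrite /tau; lra.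
have hE x : h x = E x - E (x - tau) by rewrite /h !fctE mul1r.
(* The sup bound and the support of [h] are both read off from the mean value theorem for the
   primitive [E]. *)
have mvt x y : x <= y -> exists2 c, c \in `[x, y]%R &
    E y - E x = cutoff a m k c * (y - x).
  move=> xy; apply: MVT_segment => //.
  exact/continuous_subspaceT/smooth1_continuous.
exists h; split.
- exact: smooth1B.
- by apply: is_derive_derive1 => x; exact: is_deriveB.
- move=> x; rewrite hE.
  have [|c _ ->] := mvt (x - tau) x; first by rewrite gerBl.
  rewrite opprB addrCA subrr addr0 normrM (ger0_norm tau0).
  by rewrite ger0_norm ?cutoff_ge0// ler_piMl// cutoff_le1.
- move=> x; rewrite hE negb_and -!leNgt => xab.
  have [|c] := mvt (x - tau) x; first by rewrite gerBl.
  rewrite in_itv/= => /andP[xc cx] ->; rewrite cutoff_eq0 ?mul0r//.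
  rewrite negb_and -!leNgt; case/orP: xab => [xa|bx]; apply/orP.
    by left; exact: le_trans xa.
  by right; rewrite (le_trans _ xc)// /m /tau; lra.
Qed.

End cutoff_functions.

Section tensor_test_functions.
Context {R : realType} {N : nat}.
Implicit Types F : 'I_N -> R -> R.

Definition tensor F (x : 'rV[R]_N) : R := \prod_j F j (x 0 j).

Lemma tensorD1 F i x : tensor F x = F i (x 0 i) * \prod_(j | j != i) F j (x 0 j).
Proof. by rewrite /tensor (bigD1 i). Qed.

Lemma is_derive_tensor F i x : (forall j, smooth1 (F j)) ->
  is_derive x (delta_mx 0 i : 'rV[R]_N) (tensor F)
    (tensor (fun j => if j == i then derive1 (F j) else F j) x).
Proof.
move=> sF; rewrite (tensorD1 _ i) eqxx.
under eq_bigr => j /negbTE -> do over.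
(* Along direction [i] the other factors keep the constant product [c]. *)
set c := \prod_(j | _) _.
have [dFi FiE] := smooth1_is_derive (x 0 i) (sF i).
suff cv : h^-1 *: ((tensor F \o shift x) (h *: delta_mx 0 i) - tensor F x)
    @[h --> 0^'] --> derive1 (F i) (x 0 i) * c.
  apply: DeriveDef; first by apply/cvg_ex; eexists; exact: cv.
  exact: cvg_lim cv.
rewrite (_ : (fun h => _) =
  (fun h => (h^-1 *: (F i (h *: 1 + x 0 i) - F i (x 0 i))) * c)).
  by apply: cvgMl; rewrite -FiE.
apply/funext => h /=; rewrite !(tensorD1 _ i) -/c !mxE !eqxx.
rewrite (_ : \prod_(j | j != i) F j ((h *: delta_mx 0 i + x) 0 j) = c); last first.
  apply: eq_bigr => j ji; rewrite !mxE (negbTE ji) /= mulr0 add0r//.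
by rewrite -mulrBl -scalerAl.
Qed.

Lemma partial_tensor F i : (forall j, smooth1 (F j)) ->
  partial i (tensor F) = tensor (fun j => if j == i then derive1 (F j) else F j).
Proof.
by move=> sF; apply/funext => x; have [_] := is_derive_tensor i x sF.
Qed.

Lemma tensor_continuous F : (forall j, smooth1 (F j)) -> continuous (tensor F).
Proof.
move=> sF; apply: continuous_big => [|j _ x].
- exact: mul_continuous.
- apply: (@continuous_comp _ _ _ (fun y : 'rV[R]_N => y 0 j) (F j)).
    exact: coord_continuous.
  exact: smooth1_continuous.
Qed.

Lemma smooth_tensor F : (forall j, smooth1 (F j)) -> smooth (tensor F).
Proof.
move=> sF s.
suff [F' sF' ->] : exists2 F', (forall j, smooth1 (F' j)) &
    iter_partial s (tensor F) = tensor F'.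
  split; first exact: tensor_continuous.
  by move=> i x; have [] := is_derive_tensor i x sF'.
elim: s => [|i s [F' sF' IH]]; first by exists F.
exists (fun j => if j == i then derive1 (F' j) else F' j).
  by move=> j; case: ifP => // _; exact: smooth1_derive.
by rewrite /= IH partial_tensor.
Qed.

Lemma closed_box_compact (a b : 'I_N -> R) :
  compact [set x : 'rV[R]_N | forall j, x 0 j \in `[a j, b j]].
Proof.
exact: (@rV_compact R N (fun j => `[a j, b j]%classic)
  (fun j => @segment_compact R (a j) (b j))).
Qed.

Lemma test_function_tensor F (a b : 'I_N -> R) : (forall j, smooth1 (F j)) ->
  (forall j x, x \notin `[a j, b j] -> F j x = 0) -> test_function (tensor F).
Proof.
move=> sF F0; split; first exact: smooth_tensor.
have cbox := @closed_box_compact a b.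
apply: (subclosed_compact _ cbox); first exact: closed_closure.
have hausN : hausdorff_space ('rV[R]_N) by exact: norm_hausdorff.
rewrite [X in _ `<=` X](iffLR (closure_id _) (compact_closed hausN cbox)).
apply: closure_subset => x /= Fx j; apply: contraNT Fx => xj.
by rewrite (tensorD1 _ j) F0// mul0r.
Qed.

End tensor_test_functions.

(** * Boxes and integrals against bounded functions *)

Section lebesgue_measure_of_boxes.
Context {R : realType} {N : nat}.
Local Notation mu := (lebesgueRn R N).
Local Notation rV := 'rV[R]_N.
Implicit Types (A : 'I_N -> set (measurableTypeR R)) (B : rV * rV).

(** Boxes and coordinates are measurable for the product sigma-algebra of tuples; its sets are
    Caratheodory measurable, hence measurable for row vectors. *)
Lemma measurable_row_of_tuple_preimage (S : set rV) :
  measurable ((@row_of_tuple R N) @^-1` S : set (N.-tuple (measurableTypeR R))) ->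
  measurable S.
Proof.
move=> mS; suff : lebesgue_measurable S by [].
rewrite /lebesgue_measurable /image_set_system /= setTI.
apply: sub_caratheodory; exact: sub_gen_smallest.
Qed.

Lemma measurable_rV_box A : (forall i, measurable (A i)) ->
  measurable [set x : rV | forall i, A i (x 0 i)].
Proof.
move=> /(@tuple_lebesgue_box R N)[mB _].
apply: measurable_row_of_tuple_preimage; rewrite [X in measurable X](_ : _ =
  [set t : N.-tuple (measurableTypeR R) | forall i, A i (tnth t i)])//.
by apply/seteqP; split => t /= At i; have := At i; rewrite mxE.
Qed.

Lemma measurable_coord i :
  measurable_fun setT ((fun x => x 0 i) : rV -> measurableTypeR R).
Proof.
move=> _ S mS; rewrite setTI; apply: measurable_row_of_tuple_preimage.
have := measurable_tnth i measurableT mS; rewrite setTI.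
congr measurable; by apply/seteqP; split => t /=; rewrite mxE.
Qed.

(** Half-open, so that the two halves of a box partition it exactly. Open boxes arise from the
    limits of the cutoffs, and closed boxes supply the compact sets of [L1loc]. *)
Definition box B : set rV := [set x | forall i, B.1 0 i < x 0 i <= B.2 0 i].

Definition open_box B : set rV := [set x | forall i, B.1 0 i < x 0 i < B.2 0 i].

Definition closed_box B : set rV := [set x | forall i, x 0 i \in `[B.1 0 i, B.2 0 i]].

Lemma boxE B :
  box B = [set x : rV | forall i, `]B.1 0 i, B.2 0 i]%classic (x 0 i)].
Proof. by apply/seteqP; split => x Bx i; have := Bx i; rewrite /= in_itv. Qed.

Lemma open_boxE B :
  open_box B = [set x : rV | forall i, `]B.1 0 i, B.2 0 i[%classic (x 0 i)].
Proof. by apply/seteqP; split => x Bx i; have := Bx i; rewrite /= in_itv. Qed.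

Lemma measurable_box B : measurable (box B).
Proof.
rewrite boxE.
exact: (@measurable_rV_box (fun i => `]B.1 0 i, B.2 0 i]%classic)).
Qed.

Lemma measurable_open_box B : measurable (open_box B).
Proof.
rewrite open_boxE.
exact: (@measurable_rV_box (fun i => `]B.1 0 i, B.2 0 i[%classic)).
Qed.

Lemma measurable_closed_box B : measurable (closed_box B).
Proof. exact: (@measurable_rV_box (fun i => `[B.1 0 i, B.2 0 i]%classic)). Qed.

Lemma open_box_sub B : open_box B `<=` box B.
Proof. by move=> x Bx i; have /andP[-> /ltW ->] := Bx i. Qed.

Lemma box_sub_closed B : box B `<=` closed_box B.
Proof. by move=> x Bx i; rewrite in_itv/=; have /andP[/ltW -> ->] := Bx i. Qed.

Lemma compact_closed_box B : compact (closed_box B).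
Proof. exact: (@closed_box_compact _ _ (B.1 0) (B.2 0)). Qed.

Lemma lebesgueRn_boxE B : (forall i, B.1 0 i <= B.2 0 i) ->
  mu (box B) = (\prod_i (B.2 0 i - B.1 0 i))%:E.
Proof.
move=> B12; rewrite boxE (@lebesgueRn_box _ _ (fun i => `]B.1 0 i, B.2 0 i]%classic))//.
rewrite (big_morph EFin (@EFinM R) (erefl 1%E)); apply: eq_bigr => i _.
rewrite lebesgue_measure_itv/= lte_fin; case: ltgtP (B12 i) => // -> _.
by rewrite subrr.
Qed.

Lemma lebesgueRn_closed_box_lty B : (mu (closed_box B) < +oo)%E.
Proof.
rewrite /closed_box (@lebesgueRn_box _ _ (fun i => `[B.1 0 i, B.2 0 i]%classic))//.
have -> : (\prod_(i < N) lebesgue_measure `[(B.1 0 i)%R, (B.2 0 i)%R]%classic =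
    (\prod_(i < N) (Num.max 0 (B.2 0 i - B.1 0 i))%R)%R%:E)%E.
  rewrite (big_morph EFin (@EFinM R) (erefl 1%E)); apply: eq_bigr => i _.
  rewrite lebesgue_measure_itv/= lte_fin; case: ltgtP => // h.
  - by rewrite max_r// subr_ge0 ltW.
  - by rewrite max_l// subr_le0 ltW.
  - by rewrite h subrr maxxx.
exact: ltry.
Qed.

Lemma lebesgueRn_box_lty B : (mu (box B) < +oo)%E.
Proof.
apply: le_lt_trans (lebesgueRn_closed_box_lty B).
by apply: le_measure; rewrite ?inE; [exact: measurable_box|
  exact: measurable_closed_box|exact: box_sub_closed].
Qed.

Lemma lebesgueRn_hyperplane i c : mu [set x : rV | x 0 i = c] = 0%E.
Proof.
pose A j : set (measurableTypeR R) := if j == i then [set c] else setT.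
rewrite (_ : [set _ | _] = [set x : rV | forall j, A j (x 0 j)]).
  rewrite lebesgueRn_box => [|j]; last by rewrite /A; case: ifP.
  (* The factors of the other coordinates are +oo; 0 times +oo is 0. *)
  by rewrite (bigD1 i)//= {1}/A eqxx lebesgue_measure_set1 mul0e.
apply/seteqP; split => [x /= xc j|x /(_ i)]; rewrite /A.
  by case: eqP => [->|].
by rewrite eqxx.
Qed.

(** The difference lies in the [N] upper faces, each contained in a hyperplane. *)
Lemma box_negligible B : mu (box B `\` open_box B) = 0%E.
Proof.
apply: measure_negligible.
  by apply: measurableD; [exact: measurable_box|exact: measurable_open_box].
apply: (@negligibleS _ _ _ mu (\big[setU/set0]_(i < N) [set x : rV | x 0 i = B.2 0 i])).
  move=> x [Bx]; rewrite /open_box /= -existsNE => -[i Bxi].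
  rewrite -bigcup_seq; exists i => /=; first by rewrite mem_index_enum.
  have /andP[B1x xB2] := Bx i; apply/eqP; rewrite eq_le xB2/=.
  by move: Bxi => /negP; rewrite B1x /= -leNgt.
elim/big_ind : _ => [|? ?|i _]; [exact: negligible_set0|exact: negligibleU|].
exists [set x : rV | x 0 i = B.2 0 i]; split => //; last exact: lebesgueRn_hyperplane.
have := measurable_coord i measurableT (measurable_set1 (B.2 0 i)).
by rewrite setTI.
Qed.

End lebesgue_measure_of_boxes.

Section integrals_against_bounded_functions.
Context d (T : measurableType d) (R : realType) (mu : {measure set T -> \bar R}).
Implicit Types (D : set T) (f g : T -> R).

Lemma abse_integralM_le D f g (c : R) : measurable D ->
  measurable_fun setT f -> measurable_fun setT g -> 0 <= c ->
  (forall x, `|g x| <= c * \1_D x) ->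
  (`| \int[mu]_x (f x * g x)%:E | <= c%:E * \int[mu]_(x in D) `|(f x)%:E|)%E.
Proof.
move=> mD mf mg c0 gc.
have mfg : measurable_fun setT (fun x => (f x * g x)%:E).
  by apply/measurable_EFinP; exact: measurable_funM.
have mfD : measurable_fun D (fun x => `|(f x)%:E|%E).
  by apply: measurable_funTS; apply: measurableT_comp => //; exact/measurable_EFinP.
apply: (le_trans (le_abse_integral mu measurableT mfg)).
rewrite -ge0_integralZl// (integral_mkcond D).
apply: ge0_le_integral => //.
- exact: measurableT_comp.
- by apply/(measurable_restrictT _ mD).1; exact: measurable_funeM.
- move=> x _; have := gc x; rewrite patchE indicE; case: ifPn => xD /=.
    by rewrite mulr1 -EFinM lee_fin normrM mulrC => gx; rewrite ler_wpM2r.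
  by rewrite mulr0 normr_le0 => /eqP ->; rewrite mulr0 normr0.
Qed.

Lemma cvg_integralM D f (g : nat -> T -> R) (h : T -> R) : measurable D ->
  measurable_fun setT f -> mu.-integrable D (EFin \o f) ->
  (forall k, measurable_fun setT (g k)) -> measurable_fun setT h ->
  (forall k x, `|g k x| <= \1_D x) ->
  (forall x, g k x @[k --> \oo] --> h x) ->
  (\int[mu]_x (f x * g k x)%:E @[k --> \oo] --> \int[mu]_x (f x * h x)%:E)%E.
Proof.
move=> mD mf fint mg mh gD gh.
have [] // := @dominated_convergence _ _ _ mu setT measurableT
  (fun k x => (f x * g k x)%:E) (fun x => (f x * h x)%:E)
  (abse \o ((EFin \o f) \_ D)).
- by move=> k; apply/measurable_EFinP; exact: measurable_funM.
- by apply/measurable_EFinP; exact: measurable_funM.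
- apply/aeW => x _; apply: cvg_EFin; first exact: nearW.
  by apply: cvgMr; exact: gh.
- by apply: integrable_abse; apply/(integrable_mkcond _ _).1.
- apply/aeW => x k _ /=; have := gD k x; rewrite indicE patchE.
  case: ifPn => xD /= gx; first by rewrite lee_fin normrM ler_piMr.
  by move: gx; rewrite normr_le0 => /eqP ->; rewrite mulr0 normr0.
Qed.

End integrals_against_bounded_functions.

(** * Weak gradient and the two halves of a box *)

Section difference_of_halves.
Context {R : realType} {N : nat}.
Local Notation mu := (lebesgueRn R N).
Local Notation rV := 'rV[R]_N.
Implicit Types (B : rV * rV) (u : rV -> R) (G : rV -> rV) (i j : 'I_N).

Lemma L1loc_integrable u B : L1loc u -> mu.-integrable (box B) (EFin \o u).
Proof.
move=> [mu_ ul]; apply: (@integrableS _ _ _ mu (closed_box B)).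
- exact: measurable_closed_box.
- exact: measurable_box.
- exact: box_sub_closed.
apply/integrableP; split; last exact: ul (@compact_closed_box _ _ B).
by apply/measurable_EFinP; exact: measurable_funTS.
Qed.

Definition coord_mid B i : R := (B.1 0 i + B.2 0 i) / 2.

Definition lhalf i B : rV * rV :=
  (B.1, \row_j if j == i then coord_mid B i else B.2 0 j).

Definition rhalf i B : rV * rV :=
  (\row_j if j == i then coord_mid B i else B.1 0 j, B.2).

Lemma lhalf_sub i B : (forall j, B.1 0 j <= B.2 0 j) -> box (lhalf i B) `<=` box B.
Proof.
move=> B12 x lx j; have /andP[-> xj] := lx j.
rewrite (le_trans xj)// mxE; case: eqP => // ->.
by rewrite /coord_mid; have := B12 i; lra.
Qed.

Lemma rhalf_sub i B : (forall j, B.1 0 j <= B.2 0 j) -> box (rhalf i B) `<=` box B.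
Proof.
move=> B12 x rx j; have /andP[xj ->] := rx j.
rewrite andbT (le_lt_trans _ xj)// mxE; case: eqP => // ->.
by rewrite /coord_mid; have := B12 i; lra.
Qed.

Lemma open_box_indic B x :
  \1_(open_box B) x = \prod_j ((B.1 0 j < x 0 j < B.2 0 j)%R%:R : R).
Proof.
rewrite indicE; have [Bx|Bx] := boolP (x \in open_box B).
  by rewrite big1// => j _; have := set_mem Bx j => ->.
have /existsNP[j /negP/negbTE Bj] : ~ forall j, B.1 0 j < x 0 j < B.2 0 j.
  by move=> h; move: Bx; rewrite notin_setE; exact.
by rewrite (bigD1 j)//= Bj mul0r.
Qed.

Lemma tensor_le_open_box B (F : 'I_N -> R -> R) (C : 'I_N -> R) x :
  (forall j y, `|F j y| <= C j * (B.1 0 j < y < B.2 0 j)%R%:R) ->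
  `|tensor F x| <= (\prod_j C j) * \1_(open_box B) x.
Proof.
move=> FC; rewrite open_box_indic -big_split/= /tensor normr_prod.
by apply: ler_prod => j _; rewrite normr_ge0 FC.
Qed.

Lemma measurable_tensor (F : 'I_N -> R -> R) : (forall j, smooth1 (F j)) ->
  measurable_fun setT (tensor F : rV -> R).
Proof.
move=> sF; apply: measurable_prod => j _.
apply: (@measurableT_comp _ _ _ _ _ _ (F j) _ (fun x : rV => x 0 j)).
  by apply: continuous_measurable_fun; exact: smooth1_continuous.
exact: measurable_coord.
Qed.

Lemma integral_open_box u B : L1loc u ->
  (\int[mu]_(x in box B) (u x)%:E = \int[mu]_(x in open_box B) (u x)%:E)%E.
Proof.
move=> uL; rewrite (negligible_integral _ _ (L1loc_integrable B uL) (box_negligible B)).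
- congr (integral _ _ _); rewrite setDD; apply/seteqP; split => [x []//|x Bx].
  by split => //; exact: open_box_sub.
- by apply: measurableD; [exact: measurable_box|exact: measurable_open_box].
- exact: measurable_box.
Qed.

(** As [k] grows, the i-th derivative of the test function tends to the indicator of the lower half
    minus that of the upper half, and it is dominated by the indicator of the box. Only this side
    needs a limit: the integral against [G] is bounded for every [k] through the sup norm of the
    test function, at most [tau]. *)
Lemma weak_gradient_halves u G B i : is_weak_gradient u G ->
  (forall j, B.1 0 j < B.2 0 j) ->
  (`| \int[mu]_(x in box (lhalf i B)) (u x)%:E
      - \int[mu]_(x in box (rhalf i B)) (u x)%:E |
   <= ((B.2 0 i - B.1 0 i) / 2)%:E * \int[mu]_(x in box B) `|(G x 0 i)%:E|)%E.
Proof.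
move=> [uL GL] B12; have [GiL dui] := GL i.
have B12W j : B.1 0 j <= B.2 0 j by exact: ltW.
set m := coord_mid B i; set tau := (B.2 0 i - B.1 0 i) / 2.
have tau0 : 0 <= tau by rewrite /tau; have := B12W i; lra.
have /choice[h hP] k := hat_function k (B12W i).
pose F k j := if j == i then h k else cutoff (B.1 0 j) (B.2 0 j) k.
have sF k j : smooth1 (F k j).
  rewrite /F; case: ifP => _; last exact: smooth1_cutoff.
  by have [] := hP k.
have F0 k j x : ~~ (B.1 0 j < x < B.2 0 j) -> F k j x = 0.
  rewrite /F; case: eqP => [->|_]; last exact: cutoff_eq0.
  by have [_ _ _] := hP k; exact.
pose F' k j := if j == i then derive1 (F k j) else F k j.
have F'E k j : F' k j = if j == i then
    (fun x => cutoff (B.1 0 i) m k x - cutoff m (B.2 0 i) k x)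
    else cutoff (B.1 0 j) (B.2 0 j) k.
  by rewrite /F' /F; case: eqP => // _; have [] := hP k.
have sF' k j : smooth1 (F' k j).
  by rewrite /F'; case: ifP => // _; exact: smooth1_derive.
have test_phi k : test_function (tensor (F k)).
  apply: (@test_function_tensor _ _ _ (B.1 0) (B.2 0)) => // j x xj.
  apply: F0; apply: contra xj => /andP[/ltW ax /ltW xb].
  by rewrite in_itv/= ax.
have wk k : (\int[mu]_x (u x * tensor (F' k) x)%:E =
    - \int[mu]_x (G x 0 i * tensor (F k) x)%:E)%E.
  by rewrite -dui// partial_tensor.
(* Sup bounds of the factors: [tau] for the tent, 1 for each cutoff. *)
pose cl j : R := if j == i then tau else 1.
have prod_cl : \prod_j cl j = tau.
  by rewrite (bigD1 i)//= /cl eqxx big1 ?mulr1// => j /negbTE ->.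
have F_le k x : `|tensor (F k) x| <= tau * \1_(open_box B) x.
  rewrite -prod_cl; apply: tensor_le_open_box => j y.
  case: (boolP (B.1 0 j < y < B.2 0 j)) => [yB|/(F0 k j) ->]; last first.
    by rewrite normr0 mulr0.
  rewrite mulr1 /F /cl; case: eqP => [_|_]; first by have [] := hP k.
  by rewrite ger0_norm ?cutoff_ge0 ?cutoff_le1.
have F'_le k x : `|tensor (F' k) x| <= \1_(open_box B) x.
  apply: (le_trans (@tensor_le_open_box B (F' k) (fun=> 1) x _)); last first.
    by rewrite big1 ?mul1r.
  move=> j y; rewrite mul1r F'E.
  case: (boolP (B.1 0 j < y < B.2 0 j)) => [yB|yB].
    case: ifP => _; last by rewrite ger0_norm ?cutoff_ge0 ?cutoff_le1.
    have := cutoff_ge0 (B.1 0 i) m k y; have := cutoff_le1 (B.1 0 i) m k y.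
    have := cutoff_ge0 m (B.2 0 i) k y; have := cutoff_le1 m (B.2 0 i) k y.
    by rewrite ler_norml -[true%:R]/(1 : R) => *; apply/andP; split; lra.
  have Bim : B.1 0 i < m < B.2 0 i by rewrite /m /coord_mid; have := B12 i; lra.
  case: eqP => [ji|_]; last by rewrite cutoff_eq0 ?normr0.
  rewrite !cutoff_eq0 ?subrr ?normr0//; apply: contra yB; rewrite ji; lra.
pose chi x : R := \1_(open_box (lhalf i B)) x - \1_(open_box (rhalf i B)) x.
have F'_cvg x : tensor (F' k) x @[k --> \oo] --> chi x.
  pose c j : R := if j == i then
     (B.1 0 i < x 0 i < m)%R%:R - (m < x 0 i < B.2 0 i)%R%:R
     else (B.1 0 j < x 0 j < B.2 0 j)%R%:R.
  have -> : chi x = \prod_j c j.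
    rewrite /chi !open_box_indic [X in X - _](bigD1 i)//= [X in _ - X](bigD1 i)//=.
    rewrite [RHS](bigD1 i)//= /c eqxx !mxE eqxx mulrBl.
    by congr (_ * _ - _ * _); apply: eq_bigr => j /negbTE ji; rewrite !mxE ji.
  apply: cvg_big; first exact: mul_continuous.
  move=> j _; rewrite /c; under eq_fun do rewrite F'E.
  case: eqP => [->|_]; last exact: cutoff_cvg.
  by apply: cvgB; exact: cutoff_cvg.
have muT : measurable_fun setT u by case: uL.
have mG : measurable_fun setT (fun x => G x 0 i) by case: GiL.
have mB := measurable_box B.
have mchi : measurable_fun setT chi.
  by apply: measurable_funB; apply: measurable_indic; exact: measurable_open_box.
have F'_box k x : `|tensor (F' k) x| <= \1_(box B) x.
  apply: le_trans (F'_le k x) _; rewrite !indicE ler_nat.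
  have [xB|//] := boolP (x \in open_box B).
  by rewrite mem_set//; exact/open_box_sub/set_mem.
have dc := cvg_integralM mB muT (L1loc_integrable B uL)
  (fun k => measurable_tensor (sF' k)) mchi F'_box F'_cvg.
have int_half C : box C `<=` box B ->
    mu.-integrable setT (fun x => (u x * \1_(open_box C) x)%:E) /\
    (\int[mu]_x (u x * \1_(open_box C) x)%:E = \int[mu]_(x in box C) (u x)%:E)%E.
  move=> CB.
  have uE : (fun x => (u x * \1_(open_box C) x)%:E) = (EFin \o u) \_ (open_box C).
    apply/funext => x; rewrite patchE indicE; case: (_ \in _) => /=.
      by rewrite mulr1.
    by rewrite mulr0.
  rewrite uE; split; last by rewrite -integral_mkcond -integral_open_box.
  apply/(integrable_mkcond _ _).1; first exact: measurable_open_box.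
  apply: integrableS (L1loc_integrable C uL); [exact: measurable_box|
    exact: measurable_open_box|exact: open_box_sub].
have [il el] := int_half _ (@lhalf_sub i B B12W).
have [ir er] := int_half _ (@rhalf_sub i B B12W).
have chiE : (\int[mu]_x (u x * chi x)%:E = \int[mu]_(x in box (lhalf i B)) (u x)%:E
      - \int[mu]_(x in box (rhalf i B)) (u x)%:E)%E.
  rewrite -el -er -integralB//; apply: eq_integral => x _ /=.
  by rewrite -EFinB -mulrBr.
rewrite -chiE; apply: cvge_to_le (cvg_abse dc) _.
apply: nearW => k; rewrite wk abseN.
apply: (abse_integralM_le mu mB mG (measurable_tensor (sF k)) tau0) => x.
apply: le_trans (F_le k x) _; rewrite ler_wpM2l// !indicE ler_nat.
have [xB|//] := boolP (x \in open_box B).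
by rewrite mem_set//; exact/open_box_sub/set_mem.
Qed.

End difference_of_halves.

(** * Dyadic partitions and averages *)

Section partitions_given_by_sequences.
Context d (T : measurableType d) (R : realType) (mu : {measure set T -> \bar R}).

(** A partition of [D] is encoded by indicators that add up to that of [D]. This form survives the
    replacement of each set by two pieces and turns additivity of the integral into linearity in the
    integrand. *)
Lemma integral_partition (I : Type) (s : seq I) (E : I -> set T) D A (f : T -> R) :
  (forall i, measurable (E i)) ->
  (forall i, mu.-integrable (E i) (EFin \o f)) ->
  (forall x, \sum_(i <- s) \1_(E i) x = \1_D x :> R) -> measurable A ->
  (\int[mu]_(x in A `&` D) (f x)%:E =
   \sum_(i <- s) \int[mu]_(x in A `&` E i) (f x)%:E)%E.
Proof.
move=> mE fE sE mA.
rewrite integral_mkcond; under [RHS]eq_bigr do rewrite integral_mkcond.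
rewrite -integral_sum//; last first.
  move=> i; apply/(integrable_mkcond _ _).1; first exact: measurableI.
  by apply: integrableS (fE i); [exact: mE|exact: measurableI|exact: subIsetr].
apply: eq_integral => x _.
have patchM C : (((fun x => (f x)%:E) \_ (A `&` C)) x = (f x * \1_A x * \1_C x)%:E)%E.
  rewrite patchE in_setI !indicE.
  by case: (x \in A); case: (x \in C); rewrite /= ?mulr1 ?mulr0 ?mul0r.
rewrite patchM -sE mulr_sumr -sumEFin.
by apply: eq_bigr => i _; rewrite patchM.
Qed.

(** At [x] the indicators add up to at most 1 and that of [E i] is 1, so all the others vanish. *)
Lemma partition_sumE (I : eqType) (s : seq I) (E : I -> set T) D i x (c : I -> R) :
  \sum_(j <- s) \1_(E j) x = \1_D x :> R -> i \in s -> E i x ->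
  \sum_(j <- s) c j * \1_(E j) x = c i.
Proof.
move=> sE si Eix; rewrite (big_rem i)//= indicE mem_set// mulr1.
move: sE; rewrite (big_rem i)//= [X in X + _]indicE mem_set// => sE.
have : \sum_(j <- rem i s) \1_(E j) x <= 0 :> R.
  rewrite -(lerD2l 1) addr0 sE indicE; by case: (_ \in _).
rewrite le_eqVlt ltNge sumr_ge0 ?orbF// => /eqP/eqP.
rewrite psumr_eq0// => /allP s0; rewrite big_seq big1 ?addr0// => j /s0.
by move=> /eqP ->; rewrite mulr0.
Qed.

Lemma partition_sub (I : eqType) (s : seq I) (E : I -> set T) D i :
  (forall x, \sum_(j <- s) \1_(E j) x = \1_D x :> R) -> i \in s -> E i `<=` D.
Proof.
move=> sE si x Eix; move: (sE x); rewrite (big_rem i)//= indicE mem_set// => s1.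
have : 0 < \1_D x :> R by rewrite -s1 ltr_pwDl// sumr_ge0.
by rewrite indicE ltr0n lt0b => /set_mem.
Qed.

Lemma partition_cover (I : eqType) (s : seq I) (E : I -> set T) D x :
  \sum_(j <- s) \1_(E j) x = \1_D x :> R -> D x -> exists2 i, i \in s & E i x.
Proof.
move=> sE Dx; apply/not_exists2P => sN.
move: sE; rewrite [RHS]indicE mem_set// big_seq big1 => [/eqP|i si].
  by rewrite eq_sym oner_eq0.
rewrite indicE memNset// => Eix.
by have [] := sN i.
Qed.

End partitions_given_by_sequences.

Section dyadic_partitions.
Context {R : realType} {N : nat}.
Local Notation mu := (lebesgueRn R N).
Local Notation rV := 'rV[R]_N.
Implicit Types (B : rV * rV) (bs : seq (rV * rV)) (u : rV -> R)
  (L : 'I_N -> R) (i j : 'I_N).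

Definition proper_box B := forall j, B.1 0 j < B.2 0 j.

Lemma proper_lhalf i B : proper_box B -> proper_box (lhalf i B).
Proof.
by move=> B12 j; rewrite /= mxE; case: eqP => // ->; rewrite /coord_mid;
  have := B12 i; lra.
Qed.

Lemma proper_rhalf i B : proper_box B -> proper_box (rhalf i B).
Proof.
by move=> B12 j; rewrite /= mxE; case: eqP => // ->; rewrite /coord_mid;
  have := B12 i; lra.
Qed.

Lemma box_indic B x :
  \1_(box B) x = \prod_j ((B.1 0 j < x 0 j <= B.2 0 j)%R%:R : R).
Proof.
rewrite indicE; have [Bx|Bx] := boolP (x \in box B).
  by rewrite big1// => j _; have := set_mem Bx j => ->.
have /existsNP[j /negP/negbTE Bj] : ~ forall j, B.1 0 j < x 0 j <= B.2 0 j.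
  by move=> h; move: Bx; rewrite notin_setE; exact.
by rewrite (bigD1 j)//= Bj mul0r.
Qed.

Lemma box_halves_indic i B x : proper_box B ->
  \1_(box (lhalf i B)) x + \1_(box (rhalf i B)) x = \1_(box B) x :> R.
Proof.
move=> B12; rewrite !box_indic [X in X + _](bigD1 i)//= [X in _ + X](bigD1 i)//=.
rewrite [RHS](bigD1 i)//= !mxE eqxx.
set cl := \prod_(j | _) _; set cr := \prod_(j | _) _; set c := \prod_(j | _) _.
have -> : cl = c by apply: eq_bigr => j /negbTE ji; rewrite !mxE ji.
have -> : cr = c by apply: eq_bigr => j /negbTE ji; rewrite !mxE ji.
rewrite -mulrDl -natrD; congr (_%:R * _).
have := B12 i; rewrite /coord_mid; set a := B.1 0 i; set b := B.2 0 i => ab.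
have [xm|mx] := leP (x 0 i) ((a + b) / 2).
  by rewrite andbT addn0 (le_trans xm) ?andbT//; lra.
by rewrite andbF add0n (lt_trans _ mx)//; lra.
Qed.

Definition volume B : R := \prod_j (B.2 0 j - B.1 0 j).

Lemma volume_gt0 B : proper_box B -> 0 < volume B.
Proof. by move=> B12; apply: prodr_gt0 => j _; rewrite subr_gt0. Qed.

Lemma volume_lhalf i B : volume (lhalf i B) = volume B / 2.
Proof.
rewrite /volume (bigD1 i)//= [in RHS](bigD1 i)//= mxE eqxx /coord_mid mulrAC.
congr (_ * _); first by field.
by apply: eq_bigr => j /negbTE ji; rewrite mxE ji.
Qed.

Lemma volume_rhalf i B : volume (rhalf i B) = volume B / 2.
Proof.
rewrite /volume (bigD1 i)//= [in RHS](bigD1 i)//= mxE eqxx /coord_mid mulrAC.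
congr (_ * _); first by field.
by apply: eq_bigr => j /negbTE ji; rewrite mxE ji.
Qed.

Lemma lebesgueRn_proper_box B : proper_box B -> mu (box B) = (volume B)%:E.
Proof. by move=> B12; rewrite lebesgueRn_boxE// => j; exact/ltW. Qed.

(* [box B0] is the disjoint union of the boxes of [bs], whose sides are at
   most [L j]. *)
Definition box_partition B0 L bs :=
  [/\ forall x, \sum_(B <- bs) \1_(box B) x = \1_(box B0) x :> R,
      forall B, B \in bs -> proper_box B &
      forall B, B \in bs -> forall j, B.2 0 j - B.1 0 j <= L j].

Definition bisect i bs := flatten [seq [:: lhalf i B; rhalf i B] | B <- bs].

Lemma big_bisect (V : nmodType) (F : rV * rV -> V) i bs :
  \sum_(B <- bisect i bs) F B = \sum_(B <- bs) (F (lhalf i B) + F (rhalf i B)).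
Proof.
rewrite /bisect big_flatten big_map; apply: eq_bigr => B _.
by rewrite big_cons big_seq1.
Qed.

Lemma mem_bisect i bs C : C \in bisect i bs ->
  exists2 B, B \in bs & C = lhalf i B \/ C = rhalf i B.
Proof.
move=> /flatten_mapP[B Bs]; rewrite !inE => /orP[/eqP ->|/eqP ->]; exists B => //.
  by left.
by right.
Qed.

Lemma box_partition_bisect B0 L bs i : box_partition B0 L bs ->
  box_partition B0 (fun j => if j == i then L j / 2 else L j) (bisect i bs).
Proof.
move=> [bs1 bsp bsL]; split.
- move=> x; rewrite big_bisect -bs1; apply: eq_big_seq => B /bsp.
  exact: box_halves_indic.
- move=> C /mem_bisect[B /bsp Bp [] ->]; [exact: proper_lhalf|exact: proper_rhalf].
- move=> C /mem_bisect[B Bs [] ->] j; have := bsL _ Bs j; rewrite /= mxE;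
    by case: eqP => // ->; rewrite /coord_mid; lra.
Qed.

Definition refine bs := foldl (fun bs i => bisect i bs) bs (enum 'I_N).

Definition dyadic_boxes B0 k := iter k refine [:: B0].

Lemma box_partition_weaken B0 L L' bs : (forall j, L j <= L' j) ->
  box_partition B0 L bs -> box_partition B0 L' bs.
Proof.
by move=> LL' [b1 b2 b3]; split=> // B Bs j; apply: le_trans (LL' j); exact: b3.
Qed.

Lemma box_partition_foldl B0 L bs (s : seq 'I_N) : (forall j, 0 <= L j) ->
  box_partition B0 L bs ->
  box_partition B0 (fun j => if j \in s then L j / 2 else L j)
    (foldl (fun bs i => bisect i bs) bs s).
Proof.
elim: s L bs => [//|i s IH] L bs L0 /(box_partition_bisect i) /IH bsp /=.
(* A direction that occurs again in [s] is halved more than once; the bound counts one halving. *)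
apply: box_partition_weaken (bsp _) => j; rewrite ?inE; have := L0 j.
  by case: (j == i); case: (j \in s) => /=; lra.
by case: ifP => _; lra.
Qed.

Lemma box_partition_dyadic B0 (l : R) k : proper_box B0 -> 0 <= l ->
  (forall j, B0.2 0 j - B0.1 0 j <= l) ->
  box_partition B0 (fun=> l / 2 ^+ k) (dyadic_boxes B0 k).
Proof.
move=> B0p l0 B0l; elim: k => [|k IH].
  split => [x|B|B]; first by rewrite big_seq1.
    by rewrite inE => /eqP ->.
  by rewrite inE => /eqP -> j; rewrite expr0 divr1.
have lk0 j : 0 <= l / 2 ^+ k by rewrite divr_ge0// exprn_ge0.
rewrite /dyadic_boxes iterS.
apply: box_partition_weaken (box_partition_foldl (enum 'I_N) lk0 IH) => j.
by rewrite mem_enum/= exprS invfM mulrA mulrAC.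
Qed.

Definition average u B : R := (\int[mu]_(x in box B) u x)%R / volume B.

(** The conditional expectation of [u] with respect to the partition [bs], extended by 0. *)
Definition step u bs x : R := \sum_(B <- bs) average u B * \1_(box B) x.

Lemma measurable_step u bs : measurable_fun setT (step u bs).
Proof.
apply: measurable_sum => B.
apply: measurable_funM; first exact: measurable_cst.
by apply: measurable_indic; exact: measurable_box.
Qed.

End dyadic_partitions.

Section L1_distance.
Context d (T : measurableType d) (R : realType) (mu : {measure set T -> \bar R}).

Lemma measurable_fun_dist (D : set T) (f g : T -> R) :
  measurable_fun setT f -> measurable_fun setT g ->
  measurable_fun D (fun x => `|f x - g x|%:E).
Proof.
move=> mf mg; apply/measurable_EFinP; apply: measurable_funTS.
by apply: measurableT_comp => //; exact: measurable_funB.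
Qed.

Lemma integral_dist_triangle (D : set T) (f g h : T -> R) : measurable D ->
  measurable_fun setT f -> measurable_fun setT g -> measurable_fun setT h ->
  (\int[mu]_(x in D) `|f x - h x|%:E <=
   \int[mu]_(x in D) `|f x - g x|%:E + \int[mu]_(x in D) `|g x - h x|%:E)%E.
Proof.
move=> mD mf mg mh.
have m := measurable_fun_dist.
rewrite -ge0_integralD//; [|exact: m|exact: m].
apply: ge0_le_integral => //; [exact: m| |].
  by apply: emeasurable_funD; exact: m.
by move=> x _; rewrite -EFinD lee_fin; exact: ler_distD.
Qed.

Lemma integral_dist_sym (D : set T) (f g : T -> R) :
  (\int[mu]_(x in D) `|f x - g x|%:E = \int[mu]_(x in D) `|g x - f x|%:E)%E.
Proof. by apply: eq_integral => x _; rewrite distrC. Qed.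

Lemma integrable_indic_lty A : measurable A -> (mu A < +oo)%E ->
  mu.-integrable setT (EFin \o (\1_A : T -> R)).
Proof.
move=> mA Afin; apply/integrableP; split.
  by apply/measurable_EFinP; exact: measurable_indic.
under eq_integral => x _ do rewrite /= ger0_norm//.
by rewrite integral_indic// setIT.
Qed.

Lemma integral_sum_indic_le (I : Type) (s : seq I) (E : I -> set T) (c : I -> R)
    (f : T -> R) :
  (forall i, measurable (E i)) -> (forall i, 0 <= c i) -> measurable_fun setT f ->
  (forall x, `|f x| <= \sum_(i <- s) c i * \1_(E i) x) ->
  (\int[mu]_x `|f x|%:E <= \sum_(i <- s) (c i)%:E * mu (E i))%E.
Proof.
move=> mE c0 mf fc.
have mI i : measurable_fun setT (fun x : T => ((c i)%:E * (\1_(E i) x)%:E)%E).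
  by apply: measurable_funeM; apply/measurable_EFinP; exact: measurable_indic.
have -> : (\sum_(i <- s) (c i)%:E * mu (E i) =
    \int[mu]_x \sum_(i <- s) ((c i)%:E * (\1_(E i) x)%:E))%E.
  rewrite ge0_integral_sum//; last by move=> i x _; rewrite -EFinM lee_fin mulr_ge0.
  apply: eq_bigr => i _; rewrite ge0_integralZl ?lee_fin//.
    by rewrite integral_indic// setIT.
  by apply/measurable_EFinP; exact: measurable_indic.
apply: ge0_le_integral => //.
- by apply/measurable_EFinP; exact: measurableT_comp.
- exact: emeasurable_sum.
- by move=> x _; rewrite sumEFin lee_fin.
Qed.

End L1_distance.

Section dyadic_averages.
Context {R : realType} {N : nat}.
Local Notation mu := (lebesgueRn R N).
Local Notation rV := 'rV[R]_N.
Implicit Types (B C : rV * rV) (bs : seq (rV * rV)) (u : rV -> R) (G : rV -> rV)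
  (L : 'I_N -> R) (i j : 'I_N).

Lemma EFin_Rintegral_box u B : L1loc u ->
  ((\int[mu]_(x in box B) u x)%R%:E = \int[mu]_(x in box B) (u x)%:E)%E.
Proof.
by move=> uL; rewrite fineK//; apply: integrable_fin_num;
  [exact: measurable_box|exact: L1loc_integrable].
Qed.

Lemma Rintegral_halves u B i : L1loc u -> proper_box B ->
  (\int[mu]_(x in box (lhalf i B)) u x + \int[mu]_(x in box (rhalf i B)) u x
   = \int[mu]_(x in box B) u x)%R.
Proof.
move=> uL Bp; apply: EFin_inj; rewrite EFinD !EFin_Rintegral_box//.
rewrite -[in RHS](setTI (box B)).
rewrite (@integral_partition _ _ _ mu _ [:: lhalf i B; rhalf i B] box).
- by rewrite big_cons big_seq1 !setTI.
- exact: measurable_box.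
- by move=> C; exact: L1loc_integrable.
- by move=> x; rewrite big_cons big_seq1; exact: box_halves_indic.
- exact: measurableT.
Qed.

(** If I and J are the integrals of [u] over the halves of B, the averages over the halves are 2 I /
    vol B and 2 J / vol B, and the average over B is (I + J) / vol B. The change on B is therefore
    plus or minus (I - J) / vol B, with L^1 norm |I - J|, to which [weak_gradient_halves]
    applies. *)
Lemma integral_step_bisect_le u G B0 L bs i : is_weak_gradient u G ->
  box_partition B0 L bs ->
  (\int[mu]_x `|step u (bisect i bs) x - step u bs x|%:E <=
   (L i / 2)%:E * \int[mu]_(x in box B0) `|(G x 0 i)%:E|)%E.
Proof.
move=> uG [bs1 bsp bsL]; have [uL GL] := uG; have [GiL _] := GL i.
pose I B := (\int[mu]_(x in box B) u x)%R.
pose del B := (I (lhalf i B) - I (rhalf i B)) / volume B.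
have stepE x : `|step u (bisect i bs) x - step u bs x| <=
    \sum_(B <- bs) `|del B| * \1_(box B) x.
  rewrite /step big_bisect -sumrB (le_trans (ler_norm_sum _ _ _))//.
  rewrite big_seq [leRHS]big_seq; apply: ler_sum => B /bsp Bp.
  have v0 : volume B != 0 by rewrite gt_eqF// volume_gt0.
  rewrite /average volume_lhalf volume_rhalf -(Rintegral_halves i uL Bp).
  rewrite -/(I _) -/(I _) -(box_halves_indic i x Bp).
  rewrite [X in `|X|](_ : _ = del B *
     (\1_(box (lhalf i B)) x - \1_(box (rhalf i B)) x)); last first.
    by rewrite /del; field.
  rewrite normrM ler_wpM2l// (le_trans (ler_normB _ _))// !ger0_norm//.
have mstep : measurable_fun setT (fun x => step u (bisect i bs) x - step u bs x).
  by apply: measurable_funB; exact: measurable_step.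
apply: le_trans (@integral_sum_indic_le _ _ _ mu _ bs box (fun B => `|del B|) _
  (@measurable_box R N) (fun B => normr_ge0 (del B)) mstep stepE) _.
have mB0 := measurable_box B0.
rewrite -[X in integral _ X](setTI (box B0)).
have GE (A : set rV) : (\int[mu]_(x in A) `|(G x 0%R i)%:E| =
    \int[mu]_(x in A) (`|G x 0 i|)%R%:E)%E.
  by [].
rewrite GE (@integral_partition _ _ _ mu _ bs box); last 4 first.
- exact: measurable_box.
- by move=> B; apply: (integrable_abse (L1loc_integrable B GiL)).
- exact: bs1.
- exact: measurableT.
rewrite ge0_sume_distrr; last by move=> B _; exact: integral_ge0.
rewrite big_seq [leRHS]big_seq; apply: lee_sum => B Bs.
have Bp := bsp _ Bs; rewrite setTI.
rewrite [X in (_ * X <= _)%E](lebesgueRn_proper_box Bp).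
have v0 := volume_gt0 Bp.
have -> : (`|del B|%:E * (volume B)%:E)%E = `|(I (lhalf i B))%:E - (I (rhalf i B))%:E|%E.
  rewrite -EFinM /del normrM normfV (gtr0_norm v0) divfK ?gt_eqF//.
rewrite !EFin_Rintegral_box//.
apply: le_trans (weak_gradient_halves i uG Bp) _.
by rewrite GE; apply: lee_wpmul2r; rewrite ?integral_ge0// lee_fin ler_pM2r// bsL.
Qed.

Definition gradient_mass G B0 : \bar R :=
  (\sum_i \int[mu]_(x in box B0) `|(G x 0 i)%:E|)%E.

Lemma gradient_mass_ge0 G B0 : (0 <= gradient_mass G B0)%E.
Proof. by apply: sume_ge0 => j _; exact: integral_ge0. Qed.

Lemma integral_step_foldl_le u G B0 (l : R) bs (s : seq 'I_N) :
  is_weak_gradient u G -> 0 <= l -> box_partition B0 (fun=> l) bs ->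
  (\int[mu]_x `|step u (foldl (fun bs i => bisect i bs) bs s) x - step u bs x|%:E <=
   (l / 2)%:E * \sum_(i <- s) \int[mu]_(x in box B0) `|(G x 0 i)%:E|)%E.
Proof.
move=> uG l0; elim: s bs => [|i s IH] bs bsP.
  rewrite big_nil mule0 /=; under eq_integral do rewrite subrr normr0.
  by rewrite integral0.
have bsP' : box_partition B0 (fun=> l) (bisect i bs).
  apply: box_partition_weaken (box_partition_bisect i bsP) => j.
  by case: ifP => // _; lra.
rewrite big_cons ge0_muleDr ?integral_ge0//; last first.
  by apply: sume_ge0 => j _; exact: integral_ge0.
apply: le_trans (integral_dist_triangle mu measurableT _ (measurable_step u (bisect i bs)) _) _.
- exact: measurable_step.
- exact: measurable_step.
rewrite addeC; apply: leeD; first exact: integral_step_bisect_le.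
exact: IH.
Qed.

Section dyadic.
Variables (u : rV -> R) (G : rV -> rV) (B0 : rV * rV) (l : R).
Hypotheses (uG : is_weak_gradient u G) (B0p : proper_box B0) (l0 : 0 <= l)
  (B0l : forall j, B0.2 0 j - B0.1 0 j <= l).

Lemma integral_step_dyadic_succ k :
  (\int[mu]_x `|step u (dyadic_boxes B0 k.+1) x - step u (dyadic_boxes B0 k) x|%:E <=
   (l / 2 ^+ k.+1)%:E * gradient_mass G B0)%E.
Proof.
have lk0 : 0 <= l / 2 ^+ k by rewrite divr_ge0// exprn_ge0.
have := integral_step_foldl_le (enum 'I_N) uG lk0 (box_partition_dyadic k B0p l0 B0l).
rewrite big_enum/= exprSr invfM mulrA; exact.
Qed.

(** Triangle inequality over the levels; the geometric sum is kept in closed form, which makes the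
    induction on [n] exact. *)
Lemma integral_step_dyadic k n :
  (\int[mu]_x `|step u (dyadic_boxes B0 (k + n)) x - step u (dyadic_boxes B0 k) x|%:E <=
   (l / 2 ^+ k - l / 2 ^+ (k + n))%:E * gradient_mass G B0)%E.
Proof.
have S0 := gradient_mass_ge0 G B0.
elim: n => [|n IH].
  rewrite addn0 subrr mul0e; under eq_integral do rewrite subrr normr0.
  by rewrite integral0.
apply: le_trans (integral_dist_triangle mu measurableT _
  (measurable_step u (dyadic_boxes B0 (k + n))) _) _.
- exact: measurable_step.
- exact: measurable_step.
rewrite addnS (_ : l / 2 ^+ k - l / 2 ^+ (k + n).+1 =
  l / 2 ^+ (k + n).+1 + (l / 2 ^+ k - l / 2 ^+ (k + n))); last first.
  by rewrite exprSr; field; rewrite !expf_neq0.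
rewrite EFinD ge0_muleDl ?lee_fin; last 2 first.
- by rewrite divr_ge0// exprn_ge0.
- rewrite subr_ge0 ler_wpM2l// lef_pV2 ?posrE ?exprn_gt0//.
  by rewrite ler_eXn2l ?ltr1n// leq_addr.
by apply: leeD => //; exact: integral_step_dyadic_succ.
Qed.

End dyadic.

(** [A] cuts no box of [bs]: inside the partitioned box it is a union of boxes, so averaging
    preserves the integral over it. The property survives refinement. *)
Definition adapted bs (A : set rV) :=
  forall B, B \in bs -> box B `<=` A \/ A `&` box B = set0.

Lemma adapted_bisect bs A i : (forall B, B \in bs -> proper_box B) ->
  adapted bs A -> adapted (bisect i bs) A.
Proof.
move=> bsp bsA C /mem_bisect[B Bs].
have BW j : B.1 0 j <= B.2 0 j by apply: ltW; exact: bsp.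
have sub C' : box C' `<=` box B -> box C' `<=` A \/ A `&` box C' = set0.
  move=> C'B; have [BA|AB] := bsA _ Bs; [left|right].
    exact: subset_trans BA.
  by apply/seteqP; split => // x [Ax /C'B Bx]; rewrite -AB.
by move=> [] ->; apply: sub; [exact: lhalf_sub|exact: rhalf_sub].
Qed.

Lemma adapted_dyadic B0 A k n : proper_box B0 -> adapted (dyadic_boxes B0 k) A ->
  adapted (dyadic_boxes B0 (k + n)) A.
Proof.
move=> B0p kA; pose l := \sum_j (B0.2 0 j - B0.1 0 j).
have l0 : 0 <= l by apply: sumr_ge0 => j _; rewrite subr_ge0 ltW.
have B0l j : B0.2 0 j - B0.1 0 j <= l.
  by rewrite /l (bigD1 j)//= lerDl sumr_ge0// => i _; rewrite subr_ge0 ltW.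
elim: n => [|n IH]; first by rewrite addn0.
rewrite addnS /dyadic_boxes iterS -/(dyadic_boxes _ _) /refine.
have := box_partition_dyadic (k + n) B0p l0 B0l.
elim: (enum 'I_N) (dyadic_boxes B0 (k + n)) IH => [//|i s IHs] bs bsA bsP /=.
have bsp : forall B, B \in bs -> proper_box B by case: bsP.
apply: IHs; first exact: adapted_bisect.
apply: box_partition_weaken (box_partition_bisect i bsP) => j.
case: ifP => _ //; suff : 0 <= l / 2 ^+ (k + n) by lra.
by rewrite divr_ge0// exprn_ge0.
Qed.

Lemma adapted_mem B0 L bs B : box_partition B0 L bs -> B \in bs ->
  adapted bs (box B).
Proof.
move=> [bs1 _ _] Bs C Cs; have [CB|CB] := pselect (box B `&` box C = set0).
  by right.
left; move: CB => /eqP/set0P[x [Bx Cx]].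
have [->//|CB] := eqVneq C B.
(* At the common point [x] the sum with these coefficients is 0 when evaluated through [C] and 1
   when evaluated through [B]. *)
have := partition_sumE (fun D => ((D == B)%:R : R)) (bs1 x) Cs Cx.
rewrite (partition_sumE _ (bs1 x) Bs Bx) eqxx (negbTE CB) => /eqP.
by rewrite pnatr_eq0.
Qed.

Lemma integrable_step u bs (D : set rV) : measurable D ->
  mu.-integrable D (EFin \o step u bs).
Proof.
move=> mD; apply: integrableS measurableT mD (@subsetT _ _) _.
rewrite (_ : _ \o _ =
  (fun x => \sum_(B <- bs) ((average u B)%:E * (\1_(box B) x)%:E)))%E; last first.
  by apply/funext => x /=; rewrite /step -sumEFin.
apply: integrable_sum => [|B _]; first exact: measurableT.
apply: integrableZl; first exact: measurableT.
apply: integrable_indic_lty; first exact: measurable_box.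
exact: lebesgueRn_box_lty.
Qed.

Lemma integral_step_adapted u B0 L bs (A : set rV) : L1loc u ->
  box_partition B0 L bs -> measurable A -> adapted bs A ->
  (\int[mu]_(x in A `&` box B0) (step u bs x)%:E =
   \int[mu]_(x in A `&` box B0) (u x)%:E)%E.
Proof.
move=> uL [bs1 bsp bsL] mA bsA.
rewrite (@integral_partition _ _ _ mu _ bs box); last 4 first.
- exact: measurable_box.
- by move=> C; apply: integrable_step; exact: measurable_box.
- exact: bs1.
- exact: mA.
rewrite (@integral_partition _ _ _ mu _ bs box); last 4 first.
- exact: measurable_box.
- by move=> C; exact: L1loc_integrable.
- exact: bs1.
- exact: mA.
apply: eq_big_seq => B Bs.
have [BA|->] := bsA _ Bs; last by rewrite !integral_set0.
rewrite (setIidr BA) (eq_integral (fun=> (average u B)%:E)); last first.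
  by move=> x /set_mem Bx; rewrite /step (partition_sumE _ (bs1 x) Bs Bx).
rewrite -(EFin_Rintegral_box B uL); have Bp := bsp _ Bs.
have := integral_cst mu (measurable_box B) (average u B)%:E; rewrite /cst => ->.
rewrite [X in (_ * X)%E](lebesgueRn_proper_box Bp).
by rewrite -EFinM /average divfK// gt_eqF// volume_gt0.
Qed.

End dyadic_averages.

(** * Recovery of a function from its dyadic averages *)

Section vanishing_integrals.
Context d (T : measurableType d) (R : realType) (mu : {measure set T -> \bar R}).

(** Pi-lambda argument: the sets whose trace on [D] carries a zero integral form a Dynkin system.
    The zero integral over [D] itself serves for the whole space and for complements. *)
Lemma integral_eq0_g_sigma_algebra (P : set (set T)) (D : set T) (f : T -> R) :
  setI_closed P -> (forall A, P A -> measurable A) -> measurable D ->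
  mu.-integrable D (EFin \o f) -> (\int[mu]_(x in D) (f x)%:E = 0)%E ->
  (forall A, P A -> (\int[mu]_(x in A `&` D) (f x)%:E = 0)%E) ->
  forall S, <<s P >> S -> measurable S /\ (\int[mu]_(x in S `&` D) (f x)%:E = 0)%E.
Proof.
move=> IP mP mD fD D0 P0.
pose H := [set S | measurable S /\ (\int[mu]_(x in S `&` D) (f x)%:E = 0)%E].
suff : <<s P >> `<=` H by move=> + S => /(_ S).
have fS S : measurable S -> mu.-integrable (S `&` D) (EFin \o f).
  by move=> mS; apply: integrableS fD => //; exact: measurableI.
apply: lambda_system_subset => //; last by move=> A PA; split; [exact: mP|exact: P0].
apply/dynkin_lambda_system; split => /=.
- by split; [exact: measurableT|rewrite setTI].
- move=> S [mS S0]; split; first exact: measurableC.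
  have mSC := measurableC mS.
  have := @integral_partition _ _ _ mu _ [:: true; false]
    (fun b => if b then S `&` D else ~` S `&` D) D setT f.
  rewrite big_cons big_seq1 /= !setTI D0 S0 add0e => <- //.
  + by case; exact: measurableI.
  + by case; exact: fS.
  + move=> x; rewrite big_cons big_seq1 !indicE !in_setI in_setC.
    by case: (x \in S); case: (x \in D); rewrite /= ?addr0 ?add0r.
- move=> F tF HF; have mF k : measurable (F k) by have [] := HF k.
  split; first exact: bigcupT_measurable.
  rewrite setI_bigcupl integral_bigcup.
  + by rewrite eseries0// => k _ _; have [] := HF k.
  + exact: trivIset_setIr.
  + by move=> k; exact: measurableI.
  + by rewrite -setI_bigcupl; apply: fS; exact: bigcupT_measurable.
Qed.

End vanishing_integrals.

Section identification.
Context {R : realType} {N : nat}.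
Local Notation mu := (lebesgueRn R N).
Local Notation rV := 'rV[R]_N.
Local Notation tN := (N.-tuple (measurableTypeR R)).
Implicit Types (B C : rV * rV) (i j : 'I_N).

Definition tuple_of_row (x : rV) : tN := [tuple x 0 i | i < N].

Lemma tuple_of_rowK : cancel tuple_of_row (@row_of_tuple R N).
Proof. by move=> x; apply/rowP => i; rewrite mxE tnth_mktuple. Qed.

Lemma row_of_tupleK : cancel (@row_of_tuple R N) tuple_of_row.
Proof. by move=> t; apply: eq_from_tnth => i; rewrite tnth_mktuple mxE. Qed.

(** Bridges the gap between the sigma-algebra of tuples, accessible to the pi-lambda argument, and
    its completion. Countable covers that nearly attain the outer measure give supersets [S n] of
    measure at most mu E + 1/(n+1); their intersection exceeds [E] by a null set. *)
Lemma lebesgue_measurable_hull (E : set rV) : measurable E -> (mu E < +oo)%E ->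
  exists S : set tN, [/\ measurable S, E `<=` tuple_of_row @^-1` S,
    measurable (tuple_of_row @^-1` S) & mu (tuple_of_row @^-1` S `\` E) = 0%E].
Proof.
move=> mE Efin; pose E' : set tN := (@row_of_tuple R N) @^-1` E.
pose m := tuple_lebesgue R N.
have muE : mu E = (m^*)%mu E' by [].
have mpre (S : set tN) : measurable S -> measurable (tuple_of_row @^-1` S).
  move=> mS; apply: measurable_row_of_tuple_preimage.
  by rewrite -comp_preimage (_ : _ \o _ = id)//; apply/funext; exact: row_of_tupleK.
have mupre (S : set tN) : measurable S -> mu (tuple_of_row @^-1` S) = m S.
  move=> mS; rewrite -(measurable_mu_extE m mS).
  rewrite /lebesgueRn /pushforward -comp_preimage (_ : _ \o _ = id)//.
  by apply/funext; exact: row_of_tupleK.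
have hull n : exists S : set tN,
    [/\ measurable S, E' `<=` S & (m S <= mu E + (n.+1%:R^-1)%:E)%E].
  have n0 : 0 < n.+1%:R^-1 :> R by rewrite invr_gt0.
  have Efin' : ereal_inf [set (\sum_(k <oo) m (A k))%E | A in measurable_cover E'] \is a fin_num.
    by rewrite -/(mu_ext m E') -muE ge0_fin_numE.
  have [_ [F [mF EF] <-] hF] := lb_ereal_inf_adherent n0 Efin'.
  exists (\bigcup_k F k); split => //; first exact: bigcupT_measurable.
  rewrite muE; apply: le_trans (ltW hF).
  by apply: measure_sigma_subadditive => //; exact: bigcupT_measurable.
have /choice[S hS] := hull.
exists (\bigcap_n S n).
have mS n : measurable (S n) by have [] := hS n.
have mcap : measurable (\bigcap_n S n) by exact: bigcapT_measurable.
have ES : E `<=` tuple_of_row @^-1` (\bigcap_n S n).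
  move=> x Ex n _; have [_ E'S _] := hS n; apply: E'S.
  by rewrite /E' /= tuple_of_rowK.
split => //; first exact: mpre.
have muS : (mu (tuple_of_row @^-1` (\bigcap_n S n)) <= mu E)%E.
  rewrite mupre//; apply/lee_addgt0Pr => e e0.
  have [n _ ne] := near_infty_natSinv_lt (PosNum e0).
  have [_ _ mSn] := hS n.
  apply: (@le_trans _ _ (m (S n))).
    by apply: le_measure; rewrite ?inE//; exact: bigcap_inf.
  apply: (le_trans mSn); rewrite leeD2l// lee_fin; apply/ltW; exact: ne (leqnn n).
have mpS := mpre _ mcap.
apply/eqP; rewrite -measure_le0 measureD//; last exact: le_lt_trans muS Efin.
by rewrite setIidr// sube_le0.
Qed.

Section dyadic.
Variables (B0 : rV * rV) (f : rV -> R).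
Hypotheses (B0p : proper_box B0)
  (fint : forall B, mu.-integrable (box B) (EFin \o f))
  (f0 : forall k B, B \in dyadic_boxes B0 k ->
     (\int[mu]_(x in box B) (f x)%:E = 0)%E).

Let l := \sum_j (B0.2 0 j - B0.1 0 j).

Let l0 : 0 <= l.
Proof. by apply: sumr_ge0 => j _; rewrite subr_ge0 ltW. Qed.

Let B0l j : B0.2 0 j - B0.1 0 j <= l.
Proof.
by rewrite /l (bigD1 j)//= lerDl sumr_ge0// => i _; rewrite subr_ge0 ltW.
Qed.

Let dyadicP k : box_partition B0 (fun=> l / 2 ^+ k) (dyadic_boxes B0 k).
Proof. exact: box_partition_dyadic. Qed.

(** The pi-system: two sets resolved at levels [k] and [k'] are both resolved at level [k + k'], and
    so is their intersection. *)
Let P := [set A : set rV | measurable A /\ exists k, adapted (dyadic_boxes B0 k) A].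

Let PI : setI_closed P.
Proof.
move=> A A' [mA [k kA]] [mA' [k' kA']]; split; first exact: measurableI.
have kA1 := adapted_dyadic (n := k') B0p kA.
have := adapted_dyadic (n := k) B0p kA'; rewrite addnC => kA2.
exists (k + k')%N => B Bs.
have [BA|AB] := kA1 _ Bs; last by right; rewrite setIAC AB set0I.
have [BA'|AB'] := kA2 _ Bs; last by right; rewrite -setIA AB' setI0.
by left => x Bx; split; [exact: BA|exact: BA'].
Qed.

Let P_box k B : B \in dyadic_boxes B0 k -> P (box B).
Proof.
move=> Bs; split; first exact: measurable_box.
by exists k; exact: adapted_mem (dyadicP k) Bs.
Qed.

Let P0 A : P A -> (\int[mu]_(x in A `&` box B0) (f x)%:E = 0)%E.
Proof.
move=> [mA [k kA]]; have [bs1 _ _] := dyadicP k.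
rewrite (@integral_partition _ _ _ mu _ (dyadic_boxes B0 k) box) => [|B||//|//].
- rewrite big_seq big1// => B Bs; have [BA|->] := kA _ Bs.
    by rewrite (setIidr BA) (f0 Bs).
  by rewrite integral_set0.
- exact: measurable_box.
- exact: fint.
Qed.

Lemma integral_tuple_preimage_eq0 (S : set tN) : measurable S ->
  measurable (tuple_of_row @^-1` S `&` box B0) /\
  (\int[mu]_(x in tuple_of_row @^-1` S `&` box B0) (f x)%:E = 0)%E.
Proof.
(* On [box B0] each coordinate is the limit of the functions that take, on each box
   of level k, the value of its lower corner: the coordinates are measurable for the
   sigma-algebra generated by [P], which contains the dyadic boxes. *)
move=> mS; pose T' := g_sigma_algebraType P.
(* The indicator makes [psi] vanish outside [box B0], as the approximations [h k] do; on [box B0] it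
   is [tuple_of_row]. *)
pose psi (x : T') : tN := [tuple (x : rV) 0 i * \1_(box B0) (x : rV) | i < N].
have mpsi : measurable_fun setT psi.
  apply/measurable_fun_tnthP => i.
  pose h k (x : T') := \sum_(C <- dyadic_boxes B0 k) C.1 0 i * \1_(box C) (x : rV).
  apply: (@measurable_fun_cvg _ _ _ setT h) => [k|x _].
    (* [measurable_sum] treats every [C], while only members of the partition are known to be in
       [P]; the others get the term 0. *)
    have -> : h k = (fun x => \sum_(C <- dyadic_boxes B0 k)
        (if C \in dyadic_boxes B0 k then C.1 0 i * \1_(box C) (x : rV) else 0)).
      by apply/funext => x; apply: eq_big_seq => C ->.
    apply: measurable_sum => C; have [Cs|Cs] := boolP (C \in _).
      apply: measurable_funM; first exact: measurable_cst.
      apply: measurable_indic; apply: sub_sigma_algebra; exact: P_box Cs.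
    exact: measurable_cst.
  rewrite /= tnth_mktuple.
  have [bs1 _ _] := dyadicP 0.
  have [Bx|Bx] := pselect (box B0 x); last first.
    have h0 k : h k x = 0.
      have [bsk _ _] := dyadicP k; rewrite /h big_seq big1// => C Cs.
      by rewrite indicE memNset ?mulr0// => /(partition_sub bsk Cs).
    rewrite (_ : h^~ x = cst 0); last by apply/funext.
    by rewrite indicE memNset// mulr0; exact: cvg_cst.
  rewrite indicE mem_set// mulr1.
  apply/cvgrPdist_le => e e0.
  have le0 : (fun k => l / 2 ^+ k) @ \oo --> (0 : R).
    rewrite -[X in _ --> X](mulr0 l); apply: cvgMr.
    under eq_fun do rewrite -exprVn; apply: cvg_expr.
    by rewrite ger0_norm ?invr_ge0// invf_lt1 ?ltr1n.
  move/cvgrPdist_le : le0 => /(_ _ e0) [M _ hM]; exists M => // k Mk.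
  apply: le_trans (hM k Mk).
  have [bsk _ bskL] := dyadicP k.
  have [C Cs Cx] := partition_cover (bsk x) Bx.
  rewrite /h (partition_sumE (fun C : rV * rV => C.1 0 i) (bsk x) Cs Cx).
  rewrite sub0r normrN; have := bskL _ Cs i; have /andP[] := Cx i.
  move=> Cx1 Cx2 Cl; rewrite !ger0_norm; [lra|lra|lra].
have PB0 : P (box B0) by apply: (@P_box 0); rewrite inE.
have B00 : (\int[mu]_(x in box B0) (f x)%:E = 0)%E.
  by rewrite -[X in integral _ X](setIid (box B0)); exact: P0.
have psiS : <<s P >> (psi @^-1` S).
  by rewrite -[X in <<s _ >> X]setTI; exact: mpsi measurableT _ mS.
have mP A : P A -> measurable A by case.
have [mpS pS0] := integral_eq0_g_sigma_algebra PI mP (measurable_box B0)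
  (fint B0) B00 P0 psiS.
have -> : tuple_of_row @^-1` S `&` box B0 = psi @^-1` S `&` box B0.
  apply/seteqP; split => x [Sx Bx]; split => //; move: Sx; rewrite /psi /=;
    rewrite indicE mem_set//= (_ : [tuple _ * _ | i < N] = tuple_of_row x)//;
    by apply: eq_from_tnth => i; rewrite !tnth_mktuple mulr1.
by split => //; apply: measurableI => //; exact: measurable_box.
Qed.

Lemma dyadic_integral_eq0 : ae_eq mu (box B0) (EFin \o f) (cst 0%E).
Proof.
have mB0 := measurable_box B0.
apply: (integral_ae_eq mB0 (fint B0)); first exact: measurable_cst.
move=> E EB0 mE; rewrite integral0.
have Efin : (mu E < +oo)%E.
  apply: (@le_lt_trans _ _ (mu (box B0))).
    by apply: le_measure; rewrite ?inE.
  by rewrite [X in (X < _)%E](lebesgueRn_proper_box B0p) ltry.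
(* [E] is Lebesgue measurable; it is replaced by a set from the sigma-algebra of tuples that differs
   from it by a null set. *)
have [S [mS ES mpS SE0]] := lebesgue_measurable_hull mE Efin.
have [mSB SB0] := integral_tuple_preimage_eq0 mS.
have mZ : measurable (tuple_of_row @^-1` S `\` E) by exact: measurableD.
have SBint : mu.-integrable (tuple_of_row @^-1` S `&` box B0) (EFin \o f).
  exact: integrableS mB0 mSB (@subIsetr _ _ _) (fint B0).
rewrite -SB0 [RHS](negligible_integral mZ mSB SBint SE0); congr (integral _ _ _).
apply/seteqP; split=> [x Ex|x [[Sx Bx] /not_andP[//|/contrapT//]]].
by split => [|[//]]; split; [exact: ES|exact: EB0].
Qed.

End dyadic.

End identification.

Section fast_L1_convergence.
Context d (T : measurableType d) (R : realType) (mu : {measure set T -> \bar R}).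
Variable f_ : nat -> T -> R.
Hypothesis mf_ : forall k, measurable_fun setT (f_ k).

(** The upper limit, with value 0 where it is infinite: a total measurable function, equal to the
    limit wherever the sequence converges. *)
Definition pointwise_lim (x : T) : R := fine (limn_esup (fun k => (f_ k x)%:E)).

Lemma measurable_pointwise_lim : measurable_fun setT pointwise_lim.
Proof.
apply: measurableT_comp => //.
apply: (measurable_fun_limn_esup (f := fun k x => (f_ k x)%:E)) => k.
exact/measurable_EFinP.
Qed.

Lemma cvg_pointwise_lim x : cvgn (f_ ^~ x) -> f_ k x @[k --> \oo] --> pointwise_lim x.
Proof.
move=> cf; rewrite /pointwise_lim.
have cE : (f_ k x)%:E @[k --> \oo] --> (limn (f_ ^~ x))%:E.
  by apply: cvg_EFin; [exact: nearW|exact: cf].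
by have [_ ->] := cvg_limn_einf_sup cE.
Qed.

Variables (D : set T) (C : R).
Hypothesis mD : measurable D.
Hypothesis fast : forall k,
  (\int[mu]_(x in D) `|f_ k.+1 x - f_ k x|%:E <= (C / 2 ^+ k)%:E)%E.

Let incr k x := `|f_ k.+1 x - f_ k x|.

Let g x : \bar R := (\sum_(k <oo) (incr k x)%:E)%E.

Let mincr k : measurable_fun D (fun x => (incr k x)%:E).
Proof.
apply/measurable_EFinP; apply: measurable_funTS.
by apply: measurableT_comp => //; exact: measurable_funB.
Qed.

Let incr0 k x : D x -> (0 <= (incr k x)%:E)%E.
Proof. by rewrite lee_fin /incr. Qed.

Let C0 : 0 <= C.
Proof.
have := fast 0; rewrite expr0 divr1 => h.
by rewrite -lee_fin (le_trans _ h)// integral_ge0.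
Qed.

Let g0 x : (0 <= g x)%E.
Proof. by apply: nneseries_ge0 => k _ _; rewrite lee_fin /incr. Qed.

Let mg : measurable_fun D g.
Proof.
apply: (ge0_emeasurable_sum (P := xpredT)) => [k x Dx _|k _]; first exact: incr0.
exact: mincr.
Qed.

(** Integrating the series term by term bounds the integral by the sum of the C / 2^k, that is 2
    C. *)
Let gint : mu.-integrable D g.
Proof.
apply/integrableP; split; first exact: mg.
under eq_integral do rewrite gee0_abs//.
rewrite /g integral_nneseries//.
apply: (@le_lt_trans _ _ (2 * C)%:E); last exact: ltry.
apply: lime_le.
  by apply: is_cvg_nneseries => n _ _; apply: integral_ge0 => x; exact: incr0.
apply: nearW => n.
apply: (@le_trans _ _ (\sum_(0 <= k < n) (C / 2 ^+ k)%:E)%E).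
  by apply: lee_sum => k _; exact: fast.
rewrite sumEFin lee_fin.
have := geometric_le_lim (x := 2^-1) n C0; rewrite /series/= => h.
apply: (le_trans (y := C * (1 - 2^-1)^-1)).
  under eq_bigr do rewrite -exprVn.
  by apply: h; rewrite ?invr_gt0// ger0_norm// invf_lt1 ?ltr1n.
have -> : 1 - 2^-1 = 2^-1 :> R by lra.
by rewrite invrK mulrC.
Qed.

Let sum_le_g n x : ((\sum_(0 <= k < n) incr k x)%:E <= g x)%E.
Proof.
rewrite -sumEFin; apply: nneseries_lim_ge => k _ _.
by rewrite lee_fin /incr.
Qed.

(** Where the sum [g] of the increments is finite, the telescoping series of the sequence converges
    absolutely. *)
Lemma fast_cvg_ae : {ae mu, forall x, D x -> cvgn (f_ ^~ x)}.
Proof.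
apply: filterS (integrable_ae mD gint) => x /[apply] gfin.
have nc : cvgn (series (fun k => incr k x)).
  apply: nondecreasing_is_cvgn.
    apply/nondecreasing_seqP => n; rewrite /series/= big_nat_recr//= lerDl.
    by rewrite /incr.
  exists (fine (g x)) => _ [n _ <-].
  by rewrite -lee_fin fineK//; exact: sum_le_g.
have := @normed_cvg R R^o (fun k => f_ k.+1 x - f_ k x) nc.
move=> /cvg_ex[s hs]; apply/cvg_ex; exists (f_ 0 x + s).
rewrite (_ : f_^~ x = (fun n => f_ 0 x + series (fun k => f_ k.+1 x - f_ k x) n)).
  by apply: cvgD => //; exact: cvg_cst.
apply/funext => n; exact: (eq_sum_telescope (f_^~ x)).
Qed.

(** Dominated convergence, with |f_0| + g as dominating function. *)
Lemma fast_cvg_L1 : mu.-integrable D (EFin \o f_ 0) ->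
  [/\ mu.-integrable D (EFin \o pointwise_lim),
      (\int[mu]_(x in D) `|f_ k x - pointwise_lim x|%:E @[k --> \oo] --> 0)%E &
      (\int[mu]_(x in D) (f_ k x)%:E @[k --> \oo] -->
       \int[mu]_(x in D) (pointwise_lim x)%:E)%E].
Proof.
move=> f0int.
apply: (@dominated_convergence _ _ _ mu D mD (fun k x => (f_ k x)%:E)
  (EFin \o pointwise_lim) (fun x => `|(f_ 0 x)%:E| + g x)%E).
- by move=> k; apply/measurable_EFinP; exact: measurable_funTS.
- by apply/measurable_EFinP/measurable_funTS; exact: measurable_pointwise_lim.
- apply: filterS fast_cvg_ae => x /[apply] cx; apply: cvg_EFin; first exact: nearW.
  exact: cvg_pointwise_lim.
- by apply: integrableD => //; exact: integrable_abse.
- apply/aeW => x n Dx.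
  rewrite (eq_sum_telescope (f_^~ x) n) EFinD.
  apply: le_trans (lee_abs_add _ _) _; apply: leeD => //.
  apply: le_trans (sum_le_g n x); rewrite /= lee_fin /series/=.
  exact: ler_norm_sum.
Qed.

End fast_L1_convergence.

Section approximation_by_dyadic_averages.
Context {R : realType} {N : nat}.
Local Notation mu := (lebesgueRn R N).
Local Notation rV := 'rV[R]_N.
Variables (u : rV -> R) (G : rV -> rV) (B0 : rV * rV) (l : R).
Hypotheses (uG : is_weak_gradient u G) (B0p : proper_box B0) (l0 : 0 <= l)
  (B0l : forall j, B0.2 0 j - B0.1 0 j <= l).

Let uL : L1loc u. Proof. by case: uG. Qed.

Let f_ k : rV -> R := step u (dyadic_boxes B0 k).

Let mf_ k : measurable_fun setT (f_ k). Proof. exact: measurable_step. Qed.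

Let w : rV -> R := pointwise_lim f_.

Let mw : measurable_fun setT w. Proof. exact: measurable_pointwise_lim. Qed.

Lemma gradient_mass_fin_num : gradient_mass G B0 \is a fin_num.
Proof.
apply/sum_fin_numP => j _ _; have [_ /(_ j)[GjL _]] := uG.
apply: integrable_fin_num; first exact: measurable_box.
exact: integrable_abse (L1loc_integrable B0 GjL).
Qed.

Let S := fine (gradient_mass G B0).

Let fast D k : measurable D ->
  (\int[mu]_(x in D) `|f_ k.+1 x - f_ k x|%:E <= (l * S / 2 ^+ k)%:E)%E.
Proof.
move=> mD; have mfk := measurable_fun_dist (D := setT) (mf_ k.+1) (mf_ k).
have f0 x : setT x -> (0 <= `|f_ k.+1 x - f_ k x|%:E)%E by rewrite lee_fin.
apply: le_trans (ge0_subset_integral mu mD measurableT mfk f0 (@subsetT _ _)) _.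
apply: le_trans (integral_step_dyadic_succ uG B0p l0 B0l k) _.
rewrite -(fineK gradient_mass_fin_num) -/S -EFinM lee_fin mulrAC.
rewrite ler_wpM2l ?mulr_ge0 ?fine_ge0 ?gradient_mass_ge0//.
by rewrite lef_pV2 ?posrE ?exprn_gt0// ler_eXn2l ?ltr1n.
Qed.

(** From level [k] on, [box B] is a union of boxes of the partition, so the integral of the step
    function over it is constantly that of [u]. *)
Let integral_w k B : B \in dyadic_boxes B0 k ->
  (\int[mu]_(x in box B) (w x)%:E = \int[mu]_(x in box B) (u x)%:E)%E.
Proof.
move=> Bs; have mB := measurable_box B.
have [_ _ cw] := fast_cvg_L1 mf_ mB (fun k => fast k mB) (integrable_step u _ mB).
have BP := box_partition_dyadic k B0p l0 B0l.
have BB0 : box B `<=` box B0 by case: BP => b1 _ _; exact: (partition_sub b1 Bs).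
suff cu : (\int[mu]_(x in box B) (f_ n x)%:E @[n --> \oo] -->
    \int[mu]_(x in box B) (u x)%:E)%E by exact: cvg_unique cw cu.
apply: cvg_near_cst; exists k => // n /= kn.
rewrite -(subnKC kn) -(setIidl BB0).
apply: integral_step_adapted uL (box_partition_dyadic _ B0p l0 B0l) mB _.
exact: adapted_dyadic B0p (adapted_mem BP Bs).
Qed.

Let w_eq_u : ae_eq mu (box B0) (EFin \o w) (EFin \o u).
Proof.
have mB0 := measurable_box B0.
(* The indicator makes the first term integrable on the whole space, hence on every box, as
   [dyadic_integral_eq0] asks. *)
pose f x := \1_(box B0) x * w x - u x.
have mI : measurable_fun setT (\1_(box B0) : rV -> R) by exact: measurable_indic.
have mu' : measurable_fun setT u by case: uL.
have mf : measurable_fun setT f.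
  exact: measurable_funB (measurable_funM mI mw) mu'.
have [wint _ _] := fast_cvg_L1 mf_ mB0 (fun k => fast k mB0) (integrable_step u _ mB0).
have w'int : mu.-integrable setT (fun x => (\1_(box B0) x * w x)%:E).
  rewrite (_ : (fun x => _) = (EFin \o w) \_ (box B0)).
    exact/(integrable_mkcond _ mB0).1.
  apply/funext => x; rewrite patchE indicE; case: (_ \in _); rewrite ?mul1r//.
  by rewrite mul0r.
have w'B B : mu.-integrable (box B) (fun x => (\1_(box B0) x * w x)%:E).
  exact: integrableS measurableT (measurable_box B) (@subsetT _ _) w'int.
have fint B : mu.-integrable (box B) (EFin \o f).
  by have := integrableB (measurable_box B) (w'B B) (L1loc_integrable B uL).
have f0 k B : B \in dyadic_boxes B0 k -> (\int[mu]_(x in box B) (f x)%:E = 0)%E.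
  move=> Bs; have [b1 _ _] := box_partition_dyadic k B0p l0 B0l.
  have BB0 := partition_sub b1 Bs.
  have mB := measurable_box B.
  have uB := L1loc_integrable B uL.
  have -> : (\int[mu]_(x in box B) (f x)%:E =
      \int[mu]_(x in box B) (\1_(box B0) x * w x)%R%:E
      - \int[mu]_(x in box B) (u x)%:E)%E by exact: (integralB mB (w'B B) uB).
  rewrite (_ : (\int[mu]_(x in box B) (\1_(box B0) x * w x)%R%:E =
     \int[mu]_(x in box B) (w x)%:E)%E); last first.
    by apply: eq_integral => x /set_mem /BB0 Bx; rewrite indicE mem_set// mul1r.
  rewrite (integral_w Bs) subee//; exact: integrable_fin_num.
apply: filterS (dyadic_integral_eq0 B0p fint f0) => x /= h Bx.
move: (h Bx) => [] /eqP; rewrite /f indicE mem_set// mul1r subr_eq0 => /eqP ->.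
by [].
Qed.

(** Limit in [n] of the estimate between levels [k] and [k + n]: the step functions of level [k + n]
    tend in L^1 to [w], which is [u] almost everywhere. *)
Lemma integral_dist_step k :
  (\int[mu]_(x in box B0) `|u x - step u (dyadic_boxes B0 k) x|%:E <=
   (l / 2 ^+ k)%:E * gradient_mass G B0)%E.
Proof.
have mB0 := measurable_box B0.
have mu' : measurable_fun setT u by case: uL.
have [_ c0 _] := fast_cvg_L1 mf_ mB0 (fun k => fast k mB0) (integrable_step u _ mB0).
rewrite (ae_eq_integral (fun x => `|w x - f_ k x|%:E)); last 4 first.
- exact: mB0.
- exact: measurable_fun_dist mu' (mf_ k).
- exact: measurable_fun_dist mw (mf_ k).
- by apply: filterS w_eq_u => x h Bx; have [->] := h Bx.
have c0k : (\int[mu]_(x in box B0) `|f_ (k + n)%N x - w x|%:E @[n --> \oo] --> 0)%E.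
  by have := c0; rewrite -(cvg_shiftn k); under eq_fun do rewrite addnC.
rewrite -[leRHS]add0e.
apply: (cvge_to_ge (cvgeD (fin_num_adde_defr _ _) c0k
  (cvg_cst ((l / 2 ^+ k)%:E * gradient_mass G B0)%E))); first by [].
apply: nearW => n.
apply: le_trans (integral_dist_triangle mu mB0 mw (mf_ (k + n)) (mf_ k)) _.
apply: leeD; first by rewrite integral_dist_sym.
have mfk := measurable_fun_dist (D := setT) (mf_ (k + n)) (mf_ k).
have f0 x : setT x -> (0 <= `|f_ (k + n)%N x - f_ k x|%:E)%E by rewrite lee_fin.
apply: le_trans (ge0_subset_integral mu mB0 measurableT mfk f0 (@subsetT _ _)) _.
apply: le_trans (integral_step_dyadic uG B0p l0 B0l k n) _.
apply: lee_wpmul2r; first exact: gradient_mass_ge0.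
by rewrite lee_fin gerBl divr_ge0// exprn_ge0.
Qed.

End approximation_by_dyadic_averages.

(** * Almost everywhere convergent subsequences *)

Section extraction.
Context {R : realType}.

(** Compactness of [-C, C] gives a cluster point, and an ultrafilter converges to its cluster
    points. All bounded sequences thus converge along the same [U], which replaces a diagonal
    extraction over the boxes. *)
Lemma ultrafilter_bounded_cvg (U : set_system nat) (a : nat -> R) (C : R) :
  UltraFilter U -> (forall n, `|a n| <= C) ->
  exists y, forall e, 0 < e -> U [set n | `|a n - y| <= e].
Proof.
move=> FU aC; have PU : ProperFilter U by exact: ultra_proper.
have UC : (a @ U) `[- C, C]%classic.
  apply: (@filterS _ U _ setT) filterT => n _ /=; rewrite in_itv/= -ler_norml.
  exact: aC.
have [y [_ ycl]] := @segment_compact R (- C) C (a @ U) _ UC.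
exists y => e e0.
have [//|Ue] := in_ultra_setVsetC [set n | `|a n - y| <= e] FU.
have UA : U (a @^-1` [set t | e < `|t - y|]).
  by apply: filterS Ue => n /= /negP; rewrite -ltNge.
have [t [/= te]] : [set t | e < `|t - y|] `&` ball y e !=set0.
  by apply: ycl; [exact: UA|exact: nbhsx_ballx].
by rewrite /ball/= distrC => /(lt_trans te); rewrite ltxx.
Qed.

(** Finite intersections of the [S k] with a final segment of the integers belong to [U], hence are
    nonempty. *)
Lemma ultrafilter_extraction (U : set_system nat) (S : nat -> set nat) :
  ProperFilter U -> \oo `<=` U -> (forall k, U (S k)) ->
  exists2 s : nat -> nat, {homo s : m n / (m < n)%N} &
    forall k j, (j <= k)%N -> S j (s k).
Proof.
move=> PU ooU US.
have UI k : U [set n | forall j, (j <= k)%N -> S j n].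
  elim: k => [|k IH].
    by apply: filterS (US 0) => n Sn j; rewrite leqn0 => /eqP ->.
  apply: filterS2 IH (US k.+1) => n Sk Sk1 j.
  by rewrite leq_eqVlt => /predU1P[->//|]; exact: Sk.
have next (p : nat * nat) :
    exists n, (p.1 < n)%N /\ forall j, (j <= p.2)%N -> S j n.
  have Ut : U [set n | (p.1 < n)%N] by apply: ooU; exists p.1.+1.
  have [n [/= pn Sn]] := filter_ex (filterI Ut (UI p.2)).
  by exists n; split.
have /choice[nx nxP] := next.
(* The pair holds the previous index and the level: term [k] is taken in S 0, ..., S k. *)
pose s := fix s k := if k is k'.+1 then nx (s k', k) else nx (0, 0).
exists s.
  by apply: homo_ltn => [? ? ?|k]; [exact: ltn_trans|have [] := nxP (s k, k.+1)].
by move=> [|k] j jk; [have [_] := nxP (0, 0)|have [_] := nxP (s k, k.+1)]; exact.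
Qed.

End extraction.

Section local_compactness.
Context {R : realType} {N : nat}.
Local Notation mu := (lebesgueRn R N).
Local Notation rV := 'rV[R]_N.

(** [m.+1] keeps [cube 0] nondegenerate, as the dyadic partitions require. *)
Definition cube (m : nat) : rV * rV := (const_mx (- m.+1%:R), const_mx m.+1%:R).

Lemma proper_cube m : proper_box (cube m).
Proof. by move=> j; rewrite !mxE; have := ltr0Sn R m; lra. Qed.

Lemma cube_sub m n : (m <= n)%N -> box (cube m) `<=` box (cube n).
Proof.
move=> mn x xm j; have := xm j; rewrite !mxE => /andP[mx xm'].
have mn' : m.+1%:R <= n.+1%:R :> R by rewrite ler_nat.
by rewrite (le_lt_trans _ mx) ?(le_trans xm')// lerN2.
Qed.

Lemma cube_cover x : exists m, box (cube m) x.
Proof.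
pose M := \sum_j `|x 0 j|; exists (Num.truncn M).+1 => j; rewrite !mxE.
have xM : `|x 0 j| <= M by rewrite /M (bigD1 j)//= lerDl sumr_ge0.
have Mt : M < (Num.truncn M).+1%:R by exact: truncnS_gt.
have := le_lt_trans xM Mt; rewrite ltr_norml => /andP[h1 h2].
rewrite -[(Num.truncn M).+2]addn1 natrD.
by apply/andP; split; lra.
Qed.

(** The gradient bound gives a level [k] that serves all [n], leaving finitely many averages; [g] is
    the step function built from their limits along [U]. *)
Lemma dyadic_total_boundedness (U : set_system nat) (u : nat -> rV -> R)
    (G : nat -> rV -> rV) (m : nat) (C e : R) : UltraFilter U ->
  (forall n, is_weak_gradient (u n) (G n)) ->
  (forall n, \int[mu]_(x in box (cube m)) `|u n x|%:E <= C%:E)%E ->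
  (forall n, gradient_mass (G n) (cube m) <= C%:E)%E -> 0 < e ->
  exists2 g : rV -> R, measurable_fun setT g &
    U [set n | (\int[mu]_(x in box (cube m)) `|u n x - g x|%:E <= e%:E)%E].
Proof.
move=> FU uG uC GC e0; have PU : ProperFilter U by exact: ultra_proper.
have uL n : L1loc (u n) by have [] := uG n.
have C0 : 0 <= C.
  by rewrite -lee_fin; apply: le_trans (uC 0); exact: integral_ge0.
pose l : R := 2 * m.+1%:R.
have l0 : 0 <= l by rewrite mulr_ge0.
have cl j : (cube m).2 0 j - (cube m).1 0 j <= l.
  by rewrite !mxE /l opprK; lra.
have cp := @proper_cube m.
have [k hk] : exists k, l / 2 ^+ k * C <= e / 2.
  have c0 : (fun k => (l * C) * 2^-1 ^+ k) @ \oo --> (0 : R).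
    rewrite -[X in _ --> X](mulr0 (l * C)); apply: cvgMr; apply: cvg_expr.
    by rewrite ger0_norm ?invr_ge0// invf_lt1 ?ltr1n.
  have e20 : 0 < e / 2 by rewrite divr_gt0.
  move/cvgrPdist_le : c0 => /(_ _ e20)[k _ /(_ k (leqnn k))].
  rewrite sub0r normrN exprVn => h; exists k.
  by rewrite mulrAC (le_trans (ler_norm _) h).
set bs := dyadic_boxes (cube m) k.
have bsP := box_partition_dyadic k cp l0 cl.
have [bs1 bsp _] := bsP.
pose I n B := (\int[mu]_(x in box B) u n x)%R.
have IC B : B \in bs -> forall n, `|I n B| <= C.
  move=> Bs n; rewrite -lee_fin -abse_EFin EFin_Rintegral_box//.
  have mun : measurable_fun setT (EFin \o u n).
    by apply/measurable_EFinP; case: (uL n).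
  have mB := measurable_box B.
  apply: le_trans (le_abse_integral mu mB (measurable_funTS mun)) _.
  apply: le_trans (uC n); apply: ge0_subset_integral.
  - exact: mB.
  - exact: measurable_box.
  - apply: measurable_funTS; exact: measurableT_comp mun.
  - by [].
  - exact: (partition_sub bs1 Bs).
have /choice[y yP] : forall B, exists y, B \in bs ->
    forall d, 0 < d -> U [set n | `|I n B - y| <= d].
  move=> B; have [Bs|_] := boolP (B \in bs); last by exists 0.
  by have [y yU] := ultrafilter_bounded_cvg FU (IC _ Bs); exists y.
pose g x : R := \sum_(B <- bs) y B / volume B * \1_(box B) x.
have mg : measurable_fun setT g.
  apply: measurable_sum => B; apply: measurable_funM; first exact: measurable_cst.
  by apply: measurable_indic; exact: measurable_box.
exists g => //.
(* Each box contributes at most [d] to the L^1 distance between the two step functions; the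
   successor keeps the denominator nonzero. *)
pose d := e / 2 / (size bs).+1%:R.
have d0 : 0 < d by rewrite !divr_gt0.
have Ud : U [set n | forall B, B \in bs -> `|I n B - y B| <= d].
  have : forall B, B \in bs -> U [set n | `|I n B - y B| <= d].
    by move=> B Bs; exact: yP.
  elim: (bs) => [_|B s IH h]; first by apply: filterS filterT.
  apply: filterS2 (h B (mem_head _ _)) (IH _) => [n nB ns C'|C' C's].
    by rewrite inE => /predU1P[->//|]; exact: ns.
  by apply: h; rewrite inE C's orbT.
apply: filterS Ud => n /= hn.
have mun : measurable_fun setT (u n) by case: (uL n).
have mB0 := measurable_box (cube m).
have ms := measurable_step (u n) bs.
apply: le_trans (integral_dist_triangle mu mB0 mun ms mg) _.
rewrite [e]splitr EFinD; apply: leeD.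
  apply: le_trans (integral_dist_step (uG n) cp l0 cl k) _.
  have lk0 : (0 <= (l / 2 ^+ k)%:E)%E by rewrite lee_fin divr_ge0// exprn_ge0.
  by apply: le_trans (lee_wpmul2l lk0 (GC n)) _; rewrite -EFinM lee_fin.
have mT := measurable_fun_dist (D := setT) ms mg.
have p0 x : setT x -> (0 <= `|step (u n) bs x - g x|%:E)%E by rewrite lee_fin.
apply: le_trans (ge0_subset_integral mu mB0 measurableT mT p0 (@subsetT _ _)) _.
pose c B : R := (if B \in bs then `|I n B - y B| / volume B else 0).
have c0 B : 0 <= c B.
  by rewrite /c; case: ifPn => // /bsp/volume_gt0 v0; rewrite divr_ge0// ltW.
have dc x : `|step (u n) bs x - g x| <= \sum_(B <- bs) c B * \1_(box B) x.
  rewrite /step /g -sumrB (le_trans (ler_norm_sum _ _ _))//.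
  rewrite big_seq [leRHS]big_seq; apply: ler_sum => B Bs.
  have v0 := volume_gt0 (bsp _ Bs).
  rewrite /average -/(I n B) -mulrBl -mulrBl normrM [X in _ * X <= _]ger0_norm//.
  by rewrite /c Bs normrM normfV (gtr0_norm v0).
have md : measurable_fun setT (fun x => step (u n) bs x - g x).
  exact: measurable_funB ms mg.
apply: le_trans (@integral_sum_indic_le _ _ _ mu _ bs box c _
  (@measurable_box R N) c0 md dc) _.
apply: (@le_trans _ _ (\sum_(B <- bs) d%:E)%E).
  rewrite big_seq [leRHS]big_seq; apply: lee_sum => B Bs.
  have v0 := volume_gt0 (bsp _ Bs).
  rewrite [X in (_ * X <= _)%E](lebesgueRn_proper_box (bsp _ Bs)) -EFinM lee_fin /c Bs.
  by rewrite divfK ?gt_eqF//; exact: hn.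
rewrite sumEFin lee_fin big_const_seq count_predT iter_addr_0 -[leLHS]mulr_natr /d.
rewrite mulrAC ler_pdivrMr// ler_wpM2l ?ler_nat//.
by rewrite divr_ge0// ltW.
Qed.

Theorem weak_gradient_bounded_cvg_ae (u : nat -> rV -> R) (G : nat -> rV -> rV)
    (C : nat -> R) : (forall n, is_weak_gradient (u n) (G n)) ->
  (forall m n, \int[mu]_(x in box (cube m)) `|u n x|%:E <= (C m)%:E)%E ->
  (forall m n, gradient_mass (G n) (cube m) <= (C m)%:E)%E ->
  exists2 s : nat -> nat, {homo s : m n / (m < n)%N} &
    exists2 v : rV -> R, measurable_fun setT v &
      {ae mu, forall x, u (s k) x @[k --> \oo] --> v x}.
Proof.
move=> uG uC GC.
have [U [FU ooU]] := ultraFilterLemma eventually_filter.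
have PU : ProperFilter U by exact: ultra_proper.
have e0 m : 0 < (2 ^+ m)^-1 :> R by rewrite invr_gt0 exprn_gt0.
(* Precision 2^-m is asked on the m-th cube, so that one extraction handles all cubes and makes the
   convergence fast. *)
have /choice[g gP] m : exists g : rV -> R, measurable_fun setT g /\
    U [set n | (\int[mu]_(x in box (cube m)) `|u n x - g x|%:E <= ((2 ^+ m)^-1)%:E)%E].
  have [g mg Ug] := dyadic_total_boundedness FU uG (uC m) (GC m) (e0 m).
  by exists g; split.
have [s s_incr sP] := ultrafilter_extraction PU ooU (fun m => (gP m).2).
exists s => //.
pose f k := u (s k).
have mf k : measurable_fun setT (f k) by have [[]] := uG (s k).
exists (pointwise_lim f); first exact: measurable_pointwise_lim.
(* With K = m + k, both [s K] and [s K.+1] satisfy the condition of index K: the two functions are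
   compared through [g K] on [cube K], which contains [cube m]. *)
have fast m k : (\int[mu]_(x in box (cube m)) `|f (m + k).+1 x - f (m + k)%N x|%:E
    <= (2 / 2 ^+ k)%:E)%E.
  set K := (m + k)%N; have mg : measurable_fun setT (g K) by have [] := gP K.
  have mm := measurable_box (cube m); have mK := measurable_box (cube K).
  have mT := measurable_fun_dist (D := box (cube K)) (mf K.+1) (mf K).
  have p0 x : box (cube K) x -> (0 <= `|f K.+1 x - f K x|%:E)%E by rewrite lee_fin.
  apply: le_trans (ge0_subset_integral mu mm mK mT p0 (cube_sub (leq_addr k m))) _.
  apply: le_trans (integral_dist_triangle mu mK (mf K.+1) mg (mf K)) _.
  apply: (@le_trans _ _ ((2 ^+ K)^-1 + (2 ^+ K)^-1)%:E).
    rewrite EFinD; apply: leeD; first exact: sP (leqnSn K).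
    by rewrite integral_dist_sym; exact: sP (leqnn K).
  have Kk : (2 ^+ K)^-1 <= (2 ^+ k)^-1 :> R.
    by rewrite lef_pV2 ?posrE ?exprn_gt0// ler_eXn2l ?ltr1n// leq_addl.
  by rewrite lee_fin; lra.
have cvg_ae m : {ae mu, forall x, box (cube m) x -> cvgn (f ^~ x)}.
  have fast' k : (\int[mu]_(x in box (cube m)) `|f (m + k.+1)%N x - f (m + k)%N x|%:E
      <= (2 / 2 ^+ k)%:E)%E by rewrite addnS; exact: fast.
  have := @fast_cvg_ae _ _ _ mu (fun k => f (m + k)%N) (fun k => mf (m + k)%N)
    (box (cube m)) 2 (measurable_box _) fast'.
  apply: filterS => x /[apply] /cvg_ex[t]; under eq_fun do rewrite addnC.
  by rewrite (cvg_shiftn m (f^~ x)) => ft; apply/cvg_ex; exists t.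
apply: filterS (ae_foralln cvg_ae) => x hx; apply: cvg_pointwise_lim.
by have [m] := cube_cover x; exact: hx.
Qed.

End local_compactness.

(** * Inequalities between powers and weighted integrals *)

Section powers.
Context {R : realType}.
Implicit Types a b t x y M q r theta : R.

Lemma continuous_norm_powR r : 0 < r -> continuous (fun t : R => `|t| `^ r).
Proof.
move=> r0 t; have [->|t0] := eqVneq t 0.
  rewrite /continuous_at normr0 powR0 ?gt_eqF//.
  apply/cvgrPdist_le => e e0; near=> y.
  rewrite sub0r normrN ger0_norm ?powR_ge0//.
  have -> : e = (e `^ r^-1) `^ r by rewrite -powRrM mulVf ?gt_eqF// powRr1// ltW.
  rewrite ge0_ler_powR ?nnegrE ?powR_ge0// ?(ltW r0)//.
  near: y; apply/nbhs_normP; exists (e `^ r^-1) => /=; first exact: powR_gt0.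
  by move=> y /=; rewrite sub0r normrN => /ltW.
have nt0 : 0 < `|t| by rewrite normr_gt0.
have cr : {for `|t|, continuous (fun s : R => s `^ r)}.
  apply/differentiable_continuous/derivable1_diffP.
  by apply: derivable_powR; rewrite in_itv/= nt0.
have nt : {for t, continuous (fun s : R => `|s|)} by exact: norm_continuous.
exact: (continuous_comp nt cr).
Unshelve. all: by end_near. Qed.

Lemma powR_normB_le a b q : 1 <= q ->
  `|a - b| `^ q <= 2 `^ q * (`|a| `^ q + `|b| `^ q).
Proof.
move=> q1; have q0 : 0 <= q by rewrite (le_trans _ q1).
wlog ab : a b / `|b| <= `|a|.
  move=> h; have [/h//|/ltW /h] := leP `|b| `|a|.
  by rewrite distrC (addrC (`|b| `^ q)).
apply: (@le_trans _ _ ((2 * `|a|) `^ q)).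
  apply: ge0_ler_powR => //; rewrite ?nnegrE ?mulr_ge0//.
  by rewrite (le_trans (ler_normB _ _))// mulr_natl mulr2n lerD2l.
by rewrite powRM// ler_wpM2l ?powR_ge0// lerDl powR_ge0.
Qed.

Lemma norm_le1D_powR a q : 1 <= q -> `|a| <= 1 + `|a| `^ q.
Proof.
move=> q1; have [a1|a1] := leP `|a| 1.
  by rewrite (le_trans a1)// lerDl powR_ge0.
by rewrite (le_trans (le1r_powR (ltW a1) q1))// lerDr.
Qed.

Lemma powR_geomean_diag theta y : 0 <= y -> y `^ theta * y `^ (1 - theta) = y.
Proof.
move=> y0; rewrite -powRD addrC subrK; first exact: powRr1.
by rewrite oner_eq0.
Qed.

(** If x <= t y, replace x by t y in the first factor; otherwise replace y by x / t in the
    second. *)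
Lemma geomean_le_or theta x y t : 0 < theta < 1 -> 0 <= x -> 0 <= y -> 0 < t ->
  x `^ theta * y `^ (1 - theta) <= t `^ theta * y \/
  x `^ theta * y `^ (1 - theta) <= t `^ theta * (x / t).
Proof.
move=> /andP[th0 th1] x0 y0 t0.
have th1' : 0 <= 1 - theta by rewrite subr_ge0 ltW.
have [xty|tyx] := leP x (t * y); [left|right].
  rewrite -[in leRHS](powR_geomean_diag theta y0) mulrA ler_wpM2r ?powR_ge0//.
  rewrite -powRM ?(ltW t0)// ge0_ler_powR ?nnegrE ?mulr_ge0// ltW//.
have xt0 : 0 <= x / t by rewrite divr_ge0// ltW.
rewrite -[in leRHS](powR_geomean_diag theta xt0) mulrA -powRM ?(ltW t0)//.
rewrite mulrCA divff ?gt_eqF// mulr1 ler_wpM2l ?powR_ge0//.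
by rewrite ge0_ler_powR ?nnegrE// ler_pdivlMr// mulrC ltW.
Qed.

Lemma geomean_le theta x y t : 0 < theta < 1 -> 0 <= x -> 0 <= y -> 0 < t ->
  x `^ theta * y `^ (1 - theta) <= t `^ theta * (x / t + y).
Proof.
move=> th x0 y0 t0; have t0' := ltW t0.
have [h|h] := geomean_le_or th x0 y0 t0; apply: (le_trans h);
  rewrite ler_wpM2l ?powR_ge0//.
- by rewrite lerDr divr_ge0.
- by rewrite lerDl.
Qed.

(** Here t solves t^(theta - 1) = delta, and M = t^theta. In the first case of [geomean_le_or] the
    product is at most M y and so equals the minimum; in the second it is at most delta x. *)
Lemma geomean_le_small theta (delta : R) : 0 < theta < 1 -> 0 < delta ->
  exists2 M, 0 < M & forall x y, 0 <= x -> 0 <= y ->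
    x `^ theta * y `^ (1 - theta) <=
    delta * x + Num.min (x `^ theta * y `^ (1 - theta)) (M * y).
Proof.
move=> th delta0; have /andP[th0 th1] := th.
pose t := delta `^ (- (1 - theta)^-1).
have t0 : 0 < t by exact: powR_gt0.
have th1' : 1 - theta != 0 by rewrite subr_eq0 gt_eqF.
have tdelta : t `^ theta / t = delta.
  rewrite -[X in _ / X](powRr1 (ltW t0)) -powRB; last by rewrite (gt_eqF t0) implybT.
  by rewrite -powRrM mulNr -mulrN opprB mulVf// powRr1 ?(ltW delta0).
exists (t `^ theta); [by rewrite powR_gt0|move=> x y x0 y0].
have [h|h] := geomean_le_or th x0 y0 t0.
  by rewrite min_l// lerDr mulr_ge0// ltW.
rewrite [leRHS]mulrCA [leRHS]mulrC tdelta in h.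
rewrite (le_trans h)// lerDl le_min mulr_ge0 ?powR_ge0//=.
by rewrite mulr_ge0 ?powR_ge0.
Qed.

End powers.

Section nonnegative_sequences_tending_to_0.
Context {R : realType}.
Implicit Types f : nat -> \bar R.

Lemma cvge0_le_eps f : (forall k, 0 <= f k)%E ->
  (forall e : R, 0 < e -> \forall k \near \oo, (f k <= e%:E)%E) ->
  f k @[k --> \oo] --> 0%E.
Proof.
move=> f0 fe; apply/fine_cvgP; split.
  apply: filterS (fe 1 ltr01) => k fk.
  by rewrite ge0_fin_numE// (le_lt_trans fk)// ltry.
apply/cvgrPdist_le => e e0; apply: filterS (fe e e0) => k fk /=.
have fkfin : f k \is a fin_num by rewrite ge0_fin_numE// (le_lt_trans fk)// ltry.
by rewrite sub0r normrN ger0_norm ?fine_ge0// -lee_fin fineK.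
Qed.

Lemma cvge0_near_le f (e : R) : (forall k, 0 <= f k)%E -> 0 < e ->
  f k @[k --> \oo] --> 0%E -> \forall k \near \oo, (f k <= e%:E)%E.
Proof.
move=> f0 e0 /fine_cvgP[ffin /cvgrPdist_le/(_ e e0)].
apply: filterS2 ffin => k fk; rewrite sub0r normrN ger0_norm ?fine_ge0//.
by rewrite -lee_fin fineK.
Qed.

Lemma limn_einf_le f (M : \bar R) : (forall k, f k <= M)%E -> (limn_einf f <= M)%E.
Proof.
move=> fM; rewrite limn_einf_lim; apply: lime_le; first exact: is_cvg_einfs.
apply: nearW => n; apply: le_trans (fM n); apply: ereal_inf_lbound.
by exists n => /=.
Qed.

End nonnegative_sequences_tending_to_0.

Section weighted_integrals.
Context d (T : measurableType d) (R : realType) (mu : {measure set T -> \bar R}).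
Variables (q r : R) (K V : T -> R).
Hypotheses (r0 : 0 < r) (rq : r < q) (q1 : 1 <= q).
Hypotheses (mK : measurable_fun setT K) (mV : measurable_fun setT V).
Hypotheses (K0 : forall x, 0 < K x) (V0 : forall x, 0 < V x).

Let q0 : 0 < q. Proof. exact: lt_trans rq. Qed.

Let theta := r / q.

Let theta01 : 0 < theta < 1.
Proof. by rewrite divr_gt0//= ltr_pdivrMr// mul1r. Qed.

(** With theta = r / q the exponents are 1 / (1 - theta) and - theta / (1 - theta), which is what
    makes V^theta w^(1 - theta) equal to K. *)
Definition hoelder_weight x := K x `^ (q / (q - r)) * V x `^ (- (r / (q - r))).

Local Notation w := hoelder_weight.

Let w0 x : 0 <= w x. Proof. by rewrite mulr_ge0 ?powR_ge0. Qed.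

Lemma weight_split x a : 0 <= a ->
  a `^ r * K x = (a `^ q * V x) `^ theta * w x `^ (1 - theta).
Proof.
move=> a0; have K0' := ltW (K0 x); have V0' := ltW (V0 x).
have qr0 : q - r != 0 by rewrite subr_eq0 gt_eqF.
have qn0 : q != 0 by rewrite gt_eqF.
rewrite !powRM ?powR_ge0// -!powRrM.
have -> : q * theta = r by rewrite /theta; field.
have -> : q / (q - r) * (1 - theta) = 1 by rewrite /theta; field; exact/andP.
have -> : - (r / (q - r)) * (1 - theta) = - theta.
  by rewrite /theta; field; exact/andP.
rewrite powRr1// powRN mulrACA divff ?mulr1//.
by rewrite gt_eqF// powR_gt0.
Qed.

Let mpow (u : T -> R) t (W : T -> R) : measurable_fun setT u -> measurable_fun setT W ->
  measurable_fun setT (fun x => (`|u x| `^ t * W x)%:E).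
Proof.
move=> mu_ mW; apply/measurable_EFinP; apply: measurable_funM => //.
apply: (@measurableT_comp _ _ _ _ _ _ (fun y : R => y `^ t) _ (fun x => `|u x|)).
  exact: measurable_powR.
exact: measurableT_comp.
Qed.

Let pow0 (a t b : R) : 0 < b -> (0 <= (`|a| `^ t * b)%:E)%E.
Proof. by move=> b0; rewrite lee_fin mulr_ge0 ?powR_ge0// ltW. Qed.

(** On [D], |u| <= 1 + |u|^q <= 1 + |u|^q V / c. It serves for functions with weight V and for
    gradients with exponent p and weight 1. *)
Lemma integral_le_weight (u : T -> R) (D : set T) (c s : R) : measurable_fun setT u ->
  measurable D -> (mu D < +oo)%E -> 0 < c -> (forall x, D x -> c <= V x) ->
  (\int[mu]_x (`|u x| `^ q * V x)%:E <= s%:E)%E ->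
  (\int[mu]_(x in D) `|u x|%:E <= (fine (mu D) + c^-1 * s)%:E)%E.
Proof.
move=> mu_ mD muD c0 cV Qs.
have mh := mpow q mu_ mV.
have h0 x : (0 <= (`|u x| `^ q * V x)%:E)%E by exact: pow0.
have c1 : 0 <= c^-1 by rewrite invr_ge0 ltW.
apply: (@le_trans _ _ (\int[mu]_(x in D) (cst 1%:E x + (c^-1)%:E * (`|u x| `^ q * V x)%:E))%E).
  apply: ge0_le_integral => //.
  - by apply/measurable_EFinP/measurable_funTS; exact: measurableT_comp.
  - apply: emeasurable_funD; first exact: measurable_cst.
    by apply: measurable_funeM; exact: measurable_funTS.
  - move=> x Dx; rewrite /= -EFinM -EFinD lee_fin (le_trans (norm_le1D_powR _ q1))//.
    by rewrite lerD2l mulrC -mulrA ler_peMr ?powR_ge0// ler_pdivlMr ?mul1r ?cV.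
rewrite ge0_integralD//; last 2 first.
- by move=> x _; rewrite mule_ge0.
- by apply: measurable_funeM; exact: measurable_funTS.
rewrite EFinD; apply: leeD.
  by rewrite integral_cst// mul1e fineK// ge0_fin_numE.
rewrite ge0_integralZl//; last exact: measurable_funTS.
rewrite EFinM; apply: lee_wpmul2l; first by rewrite lee_fin.
by apply: le_trans Qs; exact: ge0_subset_integral.
Qed.

Hypothesis wint : mu.-integrable setT (EFin \o w).

Let mw : measurable_fun setT w.
Proof. exact/measurable_EFinP/(measurable_int _ wint). Qed.

Let W := fine (\int[mu]_x (w x)%:E).

Let WE : (\int[mu]_x (w x)%:E = W%:E)%E.
Proof. by rewrite /W fineK// integrable_fin_num. Qed.

Lemma weight_mass_ge0 : 0 <= W.
Proof. by rewrite /W fine_ge0// integral_ge0// => x _; rewrite lee_fin. Qed.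

(** [geomean_le] at t = s: the part |u|^q V / s has integral at most 1, whence the factor 1 + W. The
    bound [s] stands in for the integral itself, which may be 0. *)
Lemma integral_weight_le (u : T -> R) (s : R) : measurable_fun setT u -> 0 < s ->
  (\int[mu]_x (`|u x| `^ q * V x)%:E <= s%:E)%E ->
  (\int[mu]_x (`|u x| `^ r * K x)%:E <= (s `^ theta * (1 + W))%:E)%E.
Proof.
move=> mu_ s0 Qs; have mh := mpow q mu_ mV.
have sth : (0 <= (s `^ theta)%:E)%E by rewrite lee_fin powR_ge0.
have s0' : (0 <= (s^-1)%:E)%E by rewrite lee_fin invr_ge0 ltW.
pose X x : \bar R := ((s^-1)%:E * (`|u x| `^ q * V x)%:E)%E.
have mX : measurable_fun setT X by exact: measurable_funeM.
have X0 x : (0 <= X x)%E by rewrite mule_ge0 ?pow0.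
have mwE : measurable_fun setT (EFin \o w) by exact/measurable_EFinP.
have mXw : measurable_fun setT (fun x => X x + (EFin \o w) x)%E.
  exact: emeasurable_funD.
have Xw0 x : (0 <= X x + (EFin \o w) x)%E.
  by apply: adde_ge0 => //; rewrite lee_fin.
apply: (@le_trans _ _ (\int[mu]_x ((s `^ theta)%:E * (X x + (EFin \o w) x)))%E).
  apply: ge0_le_integral => //.
  - by move=> x _; exact: pow0.
  - exact: mpow.
  - exact: measurable_funeM.
  - move=> x _.
    rewrite -[leRHS]/((s `^ theta * (s^-1 * (`|u x| `^ q * V x) + w x))%:E).
    rewrite lee_fin weight_split// (mulrC s^-1).
    by apply: geomean_le => //; rewrite mulr_ge0 ?powR_ge0// ltW.
rewrite ge0_integralZl// EFinM; apply: lee_wpmul2l => //.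
rewrite ge0_integralD//; last by move=> x _; rewrite lee_fin.
rewrite WE EFinD; apply: leeD => //.
rewrite /X ge0_integralZl//; last by move=> x _; exact: pow0.
apply: (@le_trans _ _ ((s^-1)%:E * s%:E)%E); first exact: lee_wpmul2l.
by rewrite -EFinM mulVf// gt_eqF.
Qed.

Variables (u_ : nat -> T -> R) (v : T -> R) (M : R).
Hypotheses (mu_ : forall k, measurable_fun setT (u_ k)) (mv : measurable_fun setT v)
  (cuv : {ae mu, forall x, u_ k x @[k --> \oo] --> v x})
  (QM : forall k, (\int[mu]_x (`|u_ k x| `^ q * V x)%:E <= M%:E)%E).

Lemma integral_weight_fatou : (\int[mu]_x (`|v x| `^ q * V x)%:E <= M%:E)%E.
Proof.
have cv : {ae mu, forall x,
    limn_einf (fun k => (`|u_ k x| `^ q * V x)%:E) = (`|v x| `^ q * V x)%:E}.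
  apply: filterS cuv => x cx.
  have : (`|u_ k x| `^ q * V x)%:E @[k --> \oo] --> (`|v x| `^ q * V x)%:E.
    apply: cvg_EFin; first exact: nearW.
    apply: cvgMl.
    exact: (continuous_cvg _ (@continuous_norm_powR _ _ q0 (v x)) cx).
  by move=> /cvg_limn_einf_sup[].
have mh k := mpow q (mu_ k) mV.
have -> : (\int[mu]_x (`|v x| `^ q * V x)%:E =
    \int[mu]_x limn_einf (fun k => (`|u_ k x| `^ q * V x)%:E))%E.
  apply: ae_eq_integral => //; first exact: mpow.
    (* [limn_einf] is by definition the opposite of the [limn_esup] of the opposites. *)
    apply: (@measurableT_comp _ _ _ _ _ _ (@oppe R)) => //.
    apply: (measurable_fun_limn_esup
      (f := fun k x => (- (`|u_ k x| `^ q * V x)%:E)%E)) => k.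
    exact: measurableT_comp.
  by apply: filterS cv => x -> _.
apply: le_trans (fatou mu measurableT mh _) _; last exact: limn_einf_le.
by move=> k x _; exact: pow0.
Qed.

Lemma integral_weight_cvg0 :
  (\int[mu]_x (`|u_ k x - v x| `^ r * K x)%:E @[k --> \oo] --> 0)%E.
Proof.
have M0 : 0 <= M.
  by rewrite -lee_fin; apply: le_trans (QM 0); apply: integral_ge0 => x _; exact: pow0.
pose h k x := `|u_ k x - v x| `^ r * K x.
have md k : measurable_fun setT (fun x => u_ k x - v x) by exact: measurable_funB.
have mh k : measurable_fun setT (fun x => (h k x)%:E).
  by rewrite /h; have := mpow r (md k) mK.
have h0 k x : 0 <= h k x by rewrite mulr_ge0 ?powR_ge0// ltW.
(* Uniform bound of the integrals of |u_k - v|^q V, from [powR_normB_le] and the Fatou bound on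
   [v]. *)
pose Q := 2 `^ q * (M + M).
have Q0 : 0 <= Q by rewrite mulr_ge0 ?powR_ge0// addr_ge0.
have Qd k : (\int[mu]_x (`|u_ k x - v x| `^ q * V x)%:E <= Q%:E)%E.
  have m1 := mpow q (mu_ k) mV; have m2 := mpow q mv mV.
  have mS : measurable_fun setT
    (fun x => (`|u_ k x| `^ q * V x)%:E + (`|v x| `^ q * V x)%:E)%E.
    exact: emeasurable_funD.
  have p1 x : (0 <= (`|u_ k x| `^ q * V x)%:E)%E by exact: pow0.
  have p2 x : (0 <= (`|v x| `^ q * V x)%:E)%E by exact: pow0.
  have pS x : (0 <= (`|u_ k x| `^ q * V x)%:E + (`|v x| `^ q * V x)%:E)%E.
    exact: adde_ge0.
  have c2 : (0 <= (2 `^ q : R)%:E)%E by rewrite lee_fin powR_ge0.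
  apply: (@le_trans _ _ (\int[mu]_x ((2 `^ q)%:E *
     ((`|u_ k x| `^ q * V x)%:E + (`|v x| `^ q * V x)%:E)))%E).
    apply: ge0_le_integral => //.
    - by move=> x _; exact: pow0.
    - by have := mpow q (md k) mV.
    - exact: measurable_funeM.
    - move=> x _; rewrite -EFinD -EFinM lee_fin -mulrDl mulrA.
      by rewrite ler_wpM2r ?(ltW (V0 x))// powR_normB_le.
  rewrite ge0_integralZl// EFinM; apply: lee_wpmul2l => //.
  rewrite ge0_integralD// EFinD; apply: leeD => //; exact: integral_weight_fatou.
apply: cvge0_le_eps => [k|e e0].
  by apply: integral_ge0 => x _; rewrite lee_fin h0.
have Q1 : 0 < 2 * (Q + 1) by rewrite mulr_gt0// ltr_wpDl.
(* Makes delta Q at most e / 2; the added 1 allows Q = 0. *)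
pose delta := e / (2 * (Q + 1)).
have delta0 : 0 < delta by rewrite divr_gt0.
have [L L0 hL] := geomean_le_small theta01 delta0.
pose g k x := Num.min (h k x) (L * w x).
have mg k : measurable_fun setT (fun x => (g k x)%:E).
  have mhk : measurable_fun setT (h k) by have /measurable_EFinP := mh k.
  have mLw : measurable_fun setT (fun x => L * w x) by exact: measurable_funM.
  by apply/measurable_EFinP; have := measurable_minr mhk mLw.
have g0 k x : 0 <= g k x by rewrite le_min h0 mulr_ge0// ltW.
have cg : (\int[mu]_x (g k x)%:E @[k --> \oo] --> 0)%E.
  have gae : {ae mu, forall x, setT x -> (g k x)%:E @[k --> \oo] --> cst 0%E x}.
    apply: filterS cuv => x cx _; apply: cvg_EFin; first exact: nearW.
    apply: (@squeeze_cvgr _ _ _ _ (cst 0) (h^~ x)).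
    - by apply: nearW => k /=; rewrite g0 ge_min lexx.
    - exact: cvg_cst.
    - rewrite -[X in _ --> X](mul0r (K x)); apply: cvgMl.
      have : u_ k x - v x @[k --> \oo] --> (0 : R).
        by rewrite -[X in _ --> X](subrr (v x)); apply: cvgB => //; exact: cvg_cst.
      move=> /(continuous_cvg _ (@continuous_norm_powR _ _ r0 0)).
      by rewrite normr0 powR0 ?gt_eqF.
  have Lwint : mu.-integrable setT (fun x => (L * w x)%:E).
    by have := integrableZl measurableT L wint.
  have gLw : {ae mu, forall x k, setT x -> (`|(g k x)%:E| <= (L * w x)%:E)%E}.
    apply/aeW => x k _; rewrite gee0_abs ?lee_fin//.
    by rewrite ge_min lexx orbT.
  have [_ _] := dominated_convergence measurableT mg (measurable_cst _) gae Lwint gLw.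
  by rewrite integral0.
have e20 : 0 < e / 2 by rewrite divr_gt0.
have gi0 k : (0 <= \int[mu]_x (g k x)%:E)%E.
  by apply: integral_ge0 => x _; rewrite lee_fin.
apply: filterS (cvge0_near_le gi0 e20 cg) => k gk.
have m1 : measurable_fun setT (fun x => (`|u_ k x - v x| `^ q * V x)%:E).
  by have := mpow q (md k) mV.
have p1 x : (0 <= (`|u_ k x - v x| `^ q * V x)%:E)%E by exact: pow0.
have d0 : (0 <= delta%:E)%E by rewrite lee_fin ltW.
have mdg : measurable_fun setT (fun x => delta%:E * (`|u_ k x - v x| `^ q * V x)%:E
    + (g k x)%:E)%E.
  by apply: emeasurable_funD (mg k); exact: measurable_funeM.
apply: (@le_trans _ _ (\int[mu]_x (delta%:E * (`|u_ k x - v x| `^ q * V x)%:E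
    + (g k x)%:E))%E).
  apply: (ge0_le_integral mu measurableT _ (mh k) mdg) => x _.
    by rewrite lee_fin h0.
  rewrite -EFinM -EFinD lee_fin /g /h weight_split//.
  by apply: hL => //; rewrite mulr_ge0 ?powR_ge0// ltW.
rewrite ge0_integralD//; last 3 first.
- by move=> x _; rewrite mule_ge0.
- exact: measurable_funeM.
- by move=> x _; rewrite lee_fin.
rewrite ge0_integralZl//.
rewrite [e]splitr EFinD; apply: leeD => //.
apply: (@le_trans _ _ (delta%:E * Q%:E)%E).
  by apply: lee_wpmul2l => //; rewrite lee_fin ltW.
have Q10 : 0 < Q + 1 by rewrite ltr_wpDl.
rewrite -EFinM lee_fin; have -> : delta * Q = e / 2 * Q / (Q + 1).
  by rewrite /delta; field; rewrite gt_eqF.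
rewrite ler_pdivrMr//.
by rewrite ler_wpM2l ?(ltW e20)// lerDl.
Qed.

End weighted_integrals.

(** * Conclusion for the weighted spaces *)

Section extended_powers.
Context {R : realType}.

Lemma poweR_le_EFin (x : \bar R) (t b : R) : (0 <= x)%E -> 0 < t -> 0 <= b ->
  (x `^ t^-1 <= b%:E)%E = (x <= (b `^ t)%:E)%E.
Proof.
move=> x0 t0 b0; have tn0 : t != 0 by rewrite gt_eqF.
case: x x0 => [x| |//]; last by rewrite poweRyr ?invr_eq0// !leye_eq.
rewrite lee_fin => x0; rewrite poweR_EFin !lee_fin; apply/idP/idP => h.
  have -> : x = (x `^ t^-1) `^ t by rewrite -powRrM mulVf// powRr1.
  by rewrite ge0_ler_powR ?nnegrE ?powR_ge0// ltW.
have -> : b = (b `^ t) `^ t^-1 by rewrite -powRrM mulfV// powRr1.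
by rewrite ge0_ler_powR ?nnegrE ?powR_ge0// invr_ge0 ltW.
Qed.

(** The integral of a nonnegative function is a supremum over the simple functions below its
    restriction, which grows with the set. Applied with an arbitrary compact set as [A]. *)
Lemma ge0_integral_subset d (T : measurableType d) (mu : {measure set T -> \bar R})
    (A B : set T) (f : T -> \bar R) : A `<=` B -> (forall x, 0 <= f x)%E ->
  (\int[mu]_(x in A) f x <= \int[mu]_(x in B) f x)%E.
Proof.
move=> AB f0; rewrite !ge0_integralE//.
apply: ereal_sup_le => _ [h hf <-]; exists h => // x; apply: le_trans (hf x) _.
rewrite !patchE; case: ifPn => [xA|_]; first by rewrite mem_set//; exact/AB/set_mem.
by case: ifPn.
Qed.

Lemma measurable_fun_norm_EFin d (T : measurableType d) (D : set T) (f : T -> R) :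
  measurable_fun setT f -> measurable_fun D (fun x => `|f x|%:E).
Proof.
by move=> mf; apply/measurable_EFinP/measurable_funTS; exact: measurableT_comp.
Qed.

End extended_powers.

Section row_vectors.
Context {R : realType} {N : nat}.
Local Notation mu := (lebesgueRn R N).
Local Notation rV := 'rV[R]_N.

Lemma compact_sub_cube (D : set rV) : compact D -> exists m, D `<=` box (cube m).
Proof.
move=> cD; have bD i : exists M : R, forall x, D x -> `|x 0 i| <= M.
  have cDi : compact ((fun x : rV => x 0 i) @` D).
    apply: continuous_compact => //; apply: continuous_subspaceT.
    exact: coord_continuous.
  have [M [_ hM]] := compact_bounded cDi.
  exists (M + 1) => x Dx; apply: (hM (M + 1)); first by rewrite ltrDl.
  by exists x.
have /choice[M hM] := bD.
pose S := \sum_i `|M i|; exists (Num.truncn S).+1 => x Dx i; rewrite !mxE.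
have xS : `|x 0 i| <= S.
  apply: (le_trans (hM i x Dx)); apply: (le_trans (ler_norm _)).
  by rewrite /S (bigD1 i)//= lerDl sumr_ge0.
have := le_lt_trans xS (truncnS_gt S); rewrite ltr_norml => /andP[h1 h2].
rewrite -[(Num.truncn S).+2]addn1 natrD.
by apply/andP; split; lra.
Qed.

Lemma norm_coord_le_enorm (v : rV) i : `|v 0 i| <= enorm v.
Proof.
rewrite -sqrtr_sqr ler_wsqrtr// (bigD1 i)//= lerDl.
by apply: sumr_ge0 => j _; exact: sqr_ge0.
Qed.

Lemma wgradP (p : R) (u : rV -> R) : D1 p u -> is_weak_gradient u (wgrad u).
Proof. by case=> _ [G uG] _; exact: (xgetPex (cst 0) (ex_intro _ G uG)). Qed.

End row_vectors.

Theorem proposition2p4 (R : realType) (N : nat) (p q r : R)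
    (K V : 'rV[R]_N -> R) (alpha : \bar R) :
  1 <= p -> p < N%:R ->
  sobolev_exponent N p <= r -> r < q ->
  measurable_fun setT K -> measurable_fun setT V ->
  (forall x, 0 < K x) -> (forall x, 0 < V x) ->
  ((q / (q - r))%:E < alpha)%E -> Lloc alpha K ->
  (forall D : set 'rV[R]_N, compact D ->
     exists2 VD : R, 0 < VD & (VD%:E <= ereal_inf [set (V x)%:E | x in D])%E) ->
  (fun x => K x `^ (q / (q - r)) * V x `^ (- (r / (q - r))))
    \in Lfun (lebesgueRn R N) 1%E ->
  compact_embedding (Mspace q p V) (wL r K) (Mnorm q p V) (wLnorm r K).
Proof.
move=> p1 pN pr rq mK mV K0 V0 _ _ Vloc /Lfun1_integrable wint.
have wI : (lebesgueRn R N).-integrable setT (EFin \o hoelder_weight q r K V).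
  exact: wint.
(* The Sobolev exponent is at least 1 because N p >= N >= N - p. *)
have r1 : 1 <= r.
  apply: le_trans pr; rewrite /sobolev_exponent ler_pdivlMr ?subr_gt0// mul1r.
  have N0 : 0 <= N%:R :> R by rewrite ler0n.
  by have := ler_peMr N0 p1; lra.
have r0 : 0 < r by rewrite (lt_le_trans _ r1).
have q1 : 1 <= q by rewrite (le_trans r1)// ltW.
have q0 : 0 < q by rewrite (lt_le_trans _ q1).
have p0 : 0 < p by rewrite (lt_le_trans _ p1).
have QV0 (u : 'rV[R]_N -> R) : (0 <= \int[lebesgueRn R N]_x (`|u x| `^ q * V x)%:E)%E.
  by apply: integral_ge0 => x _; rewrite lee_fin mulr_ge0 ?powR_ge0// ltW.
have QK0 (u : 'rV[R]_N -> R) : (0 <= \int[lebesgueRn R N]_x (`|u x| `^ r * K x)%:E)%E.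
  by apply: integral_ge0 => x _; rewrite lee_fin mulr_ge0 ?powR_ge0// ltW.
have wLnorm_le u : (wLnorm q V u <= Mnorm q p V u)%E.
  by rewrite /Mnorm leeDl// Lnorm_ge0.
have gnorm_le u : ('N[lebesgueRn R N]_p%:E[EFin \o (enorm \o wgrad u)] <= Mnorm q p V u)%E.
  by rewrite /Mnorm leeDr// poweR_ge0.
set W := fine (\int[lebesgueRn R N]_x (hoelder_weight q r K V x)%:E).
have W0 : 0 <= W by exact: weight_mass_ge0.
have YW (u : 'rV[R]_N -> R) s : measurable_fun setT u -> 0 < s ->
    (\int[lebesgueRn R N]_x (`|u x| `^ q * V x)%:E <= s%:E)%E ->
    (\int[lebesgueRn R N]_x (`|u x| `^ r * K x)%:E <= (s `^ (r / q) * (1 + W))%:E)%E.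
  by move=> mu_ s0 us; exact: (integral_weight_le r0 rq mK mV K0 V0 wI mu_ s0 us).
have XQ u : Mspace q p V u -> exists2 c : R, 0 <= c &
    (\int[lebesgueRn R N]_x (`|u x| `^ q * V x)%:E = c%:E)%E.
  move=> [_ Mu]; have : (wLnorm q V u < +oo)%E by exact: le_lt_trans Mu.
  move=> /lty_poweRy; rewrite invr_eq0 gt_eqF// => /(_ isT) Qu.
  exists (fine (\int[lebesgueRn R N]_x (`|u x| `^ q * V x)%:E)); first exact: fine_ge0.
  by rewrite fineK// ge0_fin_numE.
have XL1 u : Mspace q p V u -> L1loc u by move=> [/wgradP[]].
have Xm u : Mspace q p V u -> measurable_fun setT u by move=> /XL1[].
split.
- move=> u Xu; split; first exact: XL1.
  have [c c0 Qc] := XQ u Xu.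
  (* [YW] asks for a positive bound, while [c] may be 0. *)
  have c1 : 0 < c + 1 by rewrite ltr_wpDl.
  apply: le_lt_trans (YW u (c + 1) (Xm u Xu) c1 _) (ltry _).
  by rewrite Qc lee_fin lerDl.
(* For b above the L^q_V norm of [u], [YW] at s = b^q bounds the integral of |u|^r K by b^r (1 + W),
   hence the L^r_K norm by b (1 + W)^(1/r). *)
- exists ((1 + W) `^ r^-1) => u Xu; have [c c0 Qc] := XQ u Xu.
  set C := (1 + W) `^ r^-1.
  have C0 : 0 < C by rewrite powR_gt0// ltr_pwDl.
  apply: (@le_trans _ _ (C%:E * wLnorm q V u)%E); last first.
    by apply: lee_wpmul2l => //; rewrite lee_fin ltW.
  rewrite /wLnorm Qc poweR_EFin -EFinM.
  apply/lee_addgt0Pr => e e0; rewrite -EFinD.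
  (* Strictly above the norm, which may be 0; the excess e / C costs exactly [e] after
     multiplication by [C]. *)
  set b := c `^ q^-1 + e / C.
  have b0 : 0 < b by rewrite ltr_wpDl ?powR_ge0// divr_gt0.
  rewrite (_ : C * c `^ q^-1 + e = C * b); last by rewrite /b mulrDr mulrCA divff ?mulr1 ?gt_eqF.
  rewrite poweR_le_EFin// ?mulr_ge0 ?(ltW C0) ?(ltW b0)//.
  have bq0 : 0 < b `^ q by exact: powR_gt0.
  apply: le_trans (YW u (b `^ q) (Xm u Xu) bq0 _) _.
    have c0E : (0 <= c%:E)%E by rewrite lee_fin.
    rewrite Qc -(poweR_le_EFin c0E q0 (ltW b0)) poweR_EFin lee_fin /b lerDl.
    by rewrite divr_ge0// ltW.
  rewrite lee_fin powRM ?(ltW C0) ?(ltW b0)// -!powRrM.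
  rewrite mulVf ?gt_eqF// powRr1 ?addr_ge0// mulrCA divff ?gt_eqF// mulr1.
  by rewrite mulrC.
move=> u_ Xu [B hB].
have uX n := Xu n.
have B0 : 0 <= B.
  rewrite -lee_fin; apply: le_trans (hB 0%N); apply: le_trans (wLnorm_le _).
  exact: poweR_ge0.
have QB n : (\int[lebesgueRn R N]_x (`|u_ n x| `^ q * V x)%:E <= (B `^ q)%:E)%E.
  by rewrite -poweR_le_EFin//; apply: le_trans (wLnorm_le _) (hB n).
have uG n : is_weak_gradient (u_ n) (wgrad (u_ n)) by have [/wgradP] := Xu n.
have mE n : measurable_fun setT (enorm \o wgrad (u_ n)).
  by have [[_ _ /andP[/set_mem]]] := Xu n.
(* The weight 1 gives the gradient bound the shape that [integral_le_weight] expects. *)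
have GB n : (\int[lebesgueRn R N]_x (`|(enorm \o wgrad (u_ n)) x| `^ p * cst 1 x)%:E
    <= (B `^ p)%:E)%E.
  rewrite -poweR_le_EFin//; last first.
    by apply: integral_ge0 => x _; rewrite lee_fin mulr_ge0 ?powR_ge0.
  apply: le_trans (hB n); apply: le_trans (gnorm_le _).
  rewrite unlock /=; under eq_integral do rewrite mulr1.
  exact: lexx.
have Vcube m : exists VD : R, 0 < VD /\ forall x, box (cube m) x -> VD <= V x.
  have [VD VD0 hVD] := Vloc _ (@compact_closed_box _ _ (@cube R N m)).
  exists VD; split => // x /box_sub_closed xm.
  rewrite -lee_fin; apply: le_trans hVD _; apply: ereal_inf_lbound.
  by exists x.
have /choice[VD hVD] := Vcube.
have mcube m := measurable_box (@cube R N m).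
have mucube m := lebesgueRn_box_lty (@cube R N m).
have L1bound m (u : 'rV[R]_N -> R) : measurable_fun setT u ->
    (\int[lebesgueRn R N]_x (`|u x| `^ q * V x)%:E <= (B `^ q)%:E)%E ->
    (\int[lebesgueRn R N]_(x in box (cube m)) `|u x|%:E <=
     (fine (lebesgueRn R N (box (cube m))) + (VD m)^-1 * B `^ q)%:E)%E.
  move=> mu_ Qu; have [VD0 VDV] := hVD m.
  exact: (integral_le_weight q1 mV V0 mu_ (mcube m) (mucube m) VD0 VDV Qu).
(* The first entry bounds the functions, the second the [N] components of the gradient, each of them
   below the Euclidean norm. *)
pose C m := Num.max (fine (lebesgueRn R N (box (cube m))) + (VD m)^-1 * B `^ q)
  (N%:R * (fine (lebesgueRn R N (box (cube m))) + B `^ p)).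
have uC m n : (\int[lebesgueRn R N]_(x in box (cube m)) `|u_ n x|%:E <= (C m)%:E)%E.
  apply: le_trans (L1bound m _ (Xm _ (Xu n)) (QB n)) _.
  by rewrite lee_fin le_max lexx.
have GC m n : (gradient_mass (wgrad (u_ n)) (cube m) <= (C m)%:E)%E.
  apply: (@le_trans _ _ (\sum_(i < N) (fine (lebesgueRn R N (box (cube m))) + B `^ p)%:E)%E).
    apply: lee_sum => i _.
    have := @integral_le_weight _ _ _ (lebesgueRn R N) p (cst 1) p1 (measurable_cst _)
      (fun=> ltr01) (enorm \o wgrad (u_ n)) _ 1 _ (mE n) (mcube m) (mucube m)
      ltr01 (fun _ _ => lexx _) (GB n).
    rewrite invr1 mul1r; apply: le_trans.
    have [_ /(_ i)[[mGi _] _]] := uG n.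
    apply: ge0_le_integral.
    - exact: mcube.
    - by [].
    - exact: (measurable_fun_norm_EFin mGi).
    - exact: (measurable_fun_norm_EFin (mE n)).
    - move=> x _; rewrite lee_fin.
      by apply: le_trans (norm_coord_le_enorm _ _) (ler_norm _).
  by rewrite sumEFin lee_fin sumr_const card_ord -mulr_natl le_max lexx orbT.
have [s s_incr [v mv cv]] := weak_gradient_bounded_cvg_ae uG uC GC.
have mus k : measurable_fun setT (u_ (s k)) by exact: Xm.
(* This single bound on [v] yields both its local integrability and its membership in L^r_K. *)
have Qv := integral_weight_fatou r0 rq mV V0 mus mv cv (fun k => QB (s k)).
exists s => //; exists v.
  split.
    split => // D /compact_sub_cube[m Dm].
    apply: le_lt_trans (ge0_integral_subset (lebesgueRn R N) Dm _) _; first by move=> x.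
    by apply: le_lt_trans (L1bound m v mv Qv) (ltry _).
  have B1 : 0 < B `^ q + 1 by rewrite ltr_wpDl ?powR_ge0.
  apply: le_lt_trans (YW v (B `^ q + 1) mv B1 _) (ltry _).
  by apply: le_trans Qv _; rewrite lee_fin lerDl.
apply: cvge0_le_eps => [k|e e0]; first exact: poweR_ge0.
have er0 : 0 < e `^ r by exact: powR_gt0.
have := integral_weight_cvg0 r0 rq q1 mK mV K0 V0 wI mus mv cv (fun k => QB (s k)).
move=> /(cvge0_near_le (fun k => QK0 (fun x => u_ (s k) x - v x)) er0).
by apply: filterS => k; rewrite -poweR_le_EFin// ltW.
Qed.
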